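(* Let $\varepsilon \in (0,1)$ and let $G \sim G\left(n, \frac{1+\varepsilon}{n}\right)$. Then with high probability (i.e. with probability tending to $1$ as $n\to\infty$), $\mathrm{Dist}_{\mathrm{BP}}(G) = \Theta(\varepsilon^3)\, n$; that is, there are absolute constants $0<c_1\le c_2$ such that w.h.p. $c_1\varepsilon^3 n \le \mathrm{Dist}_{\mathrm{BP}}(G)\le c_2\varepsilon^3 n$.
   Context: $G(n,p)$ is the binomial random graph on $n$ labeled vertices in which each of the $\binom n2$ possible edges is present independently with probability $p$. For a graph $G$, $\mathrm{Dist}_{\mathrm{BP}}(G)$ (the distance of $G$ from bipartiteness) is the minimum number of edges whose removal makes $G$ bipartite; equivalently $\mathrm{Dist}_{\mathrm{BP}}(G)=|E(G)|-\mathrm{MAXCUT}(G)$, where $\mathrm{MAXCUT}(G)$ is the maximum number of edges crossing a bipartition of $V(G)$. *)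

(* Defs.v *)
From HB Require Import structures.
From mathcomp Require Import all_boot all_order all_algebra.
From mathcomp Require Import all_classical all_reals all_analysis.
Set Implicit Arguments.
Unset Strict Implicit.
Unset Printing Implicit Defensive.
Import Order.TTheory GRing.Theory Num.Theory.
Import numFieldNormedType.Exports.
Local Open Scope ring_scope.

(* A simple graph with vertex set V is identified with its edge set, a set of
   two-element subsets of V; [pairs V] is thus the complete graph on V. *)
Definition pairs (V : finType) : {set {set V}} := [set e : {set V} | #|e| == 2%N].

Definition bipartite (V : finType) (G : {set {set V}}) : bool :=
  [exists A : {set V}, [forall x : V, [forall y : V,
    ([set x; y] \in G) ==> ((x \in A) != (y \in A))]]].

Definition makes_bipartite (V : finType) (G F : {set {set V}}) : bool :=
  (F \subset G) && bipartite (G :\: F).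

(* The default G of the arg min is itself admissible: see makes_bipartite_all. *)
Definition dist_bp (V : finType) (G : {set {set V}}) : nat :=
  #|[arg min_(F < G | makes_bipartite G F) #|F| ]|.

Definition gnp_weight (R : realType) (n : nat) (p : R)
    (G : {set {set 'I_n}}) : R :=
  \prod_(e in pairs 'I_n) (if e \in G then p else 1 - p).

(* The probability that G(n, p) satisfies the property P. *)
Definition gnp_pr (R : realType) (n : nat) (p : R)
    (P : pred {set {set 'I_n}}) : R :=
  \sum_(G in powerset (pairs 'I_n) | P G) gnp_weight p G.

Lemma makes_bipartite_all (V : finType) (G : {set {set V}}) :
  makes_bipartite G G.
Proof.
rewrite /makes_bipartite subxx finset.setDv /=; apply/existsP; exists finset.set0.
by apply/forallP => x; apply/forallP => y; rewrite !inE.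
Qed.

Lemma dist_bpP (V : finType) (G : {set {set V}}) :
  (exists2 F, makes_bipartite G F & #|F| = dist_bp G) /\
  (forall F, makes_bipartite G F -> (dist_bp G <= #|F|)%N).
Proof.
rewrite /dist_bp; case: arg_minnP => [|F mF minF]; first exact: makes_bipartite_all.
by split=> //; exists F.
Qed.

Lemma gnp_prT (R : realType) (n : nat) (p : R) : gnp_pr p (@predT {set {set 'I_n}}) = 1.
Proof.
pose D := pairs 'I_n.
pose F e := if e \in D then p else 0 : R.
pose H e := if e \in D then 1 - p else 1 : R.
have FH1 : \prod_(e : {set 'I_n}) (F e + H e) = 1.
  by apply: big1 => e _; rewrite /F /H; case: ifP => _; rewrite ?add0r // addrC subrK.
rewrite -FH1 bigA_distr [RHS](bigID (mem (powerset D))) /= [X in _ + X]big1 ?addr0.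
  apply: eq_big => [G|G]; rewrite ?andbT // inE => /fintype.subsetP sGD.
  rewrite /gnp_weight big_mkcond; apply: eq_bigr => e _; rewrite /F /H -/D.
  by case: ifP => // eD; case: ifP => // /sGD; rewrite eD.
move=> G; rewrite inE => /fintype.subsetPn[e eG eD].
by rewrite (bigD1 e) //= eG /F (negbTE eD) mul0r.
Qed.

(* Main.v *)
Require Import Defs.
From mathcomp Require Import all_boot all_order all_algebra ring lra zify.
From mathcomp Require Import reals.
Set Implicit Arguments.
Unset Strict Implicit.
Unset Printing Implicit Defensive.
Import Order.TTheory GRing.Theory Num.Theory.
Local Open Scope ring_scope.

(* Changing one edge changes the distance D from bipartiteness by at most 1, so by the Efron-Stein
   inequality Var D = O(n), and by Chebyshev's inequality it suffices to show E D = Theta(eps^3) n.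

   Upper bound. Adding the pair ab can raise D only if a and b are already connected, hence E D grows
   by at most (q - p) \sum_{a,b} P_q(a ~ b) when the edge probability grows from p to q. At
   q = (1 + eta)/n a vertex lies in a large cluster with probability O(eta) (compare the exploration of
   its cluster with a branching process), and the number of such vertices is concentrated, again by
   Efron-Stein, so that the sum is O(eta^2 n^2). Take eta = eps^2 and then eta = eps.

   Lower bound. At (1 + eps/2)/n at least a constant times eps n vertices lie in clusters of size at
   least s = A/eps^2. List each such cluster so that every new vertex is inserted just after a neighbour;
   along the list a cut, compared with a fixed 2-colouring, changes at most twice per violated
   edge. Chopping the lists into N blocks of length s/8, a cut with at most N/8 violated edges is
   determined on half of the blocks by O(N) bits, and must be constant on one of 4^N fixed vertex
   sets of size at least Ns/32. Sprinkling edges with probability eps/(2n), each of these sets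
   receives more than N/8 edges up to probability 16^(-N), so the union bound gives
   D > N/8 ~ eps^3 n. *)

(** * Product measures on sets of edges *)

Section Expectation.
Variables (R : realFieldType) (T : finType).
Implicit Types (p q : T -> R) (f g : {set T} -> R) (e : T) (G E : {set T}).

(** Each edge has a probability of its own, so that edges can be changed or switched off one at a
    time; [unif (pairs 'I_n) p] gives G(n, p). *)
Definition wt p G : R := \prod_e (if e \in G then p e else 1 - p e).
Definition Ex p f : R := \sum_G wt p G * f G.
Definition upd p e (v : R) : T -> R := fun e' => if e' == e then v else p e'.
Definition unif E (x : R) : T -> R := fun e => if e \in E then x else 0.
Definition isprob p := forall e, 0 <= p e <= 1.

Lemma eq_Ex p f g : f =1 g -> Ex p f = Ex p g.
Proof. by move=> fg; apply: eq_bigr => G _; rewrite fg. Qed.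

Lemma eq_Exl p q f : p =1 q -> Ex p f = Ex q f.
Proof.
by move=> pq; apply: eq_bigr => G _; congr (_ * _); apply: eq_bigr => e _; rewrite pq.
Qed.

Lemma ExD p f g : Ex p (fun G => f G + g G) = Ex p f + Ex p g.
Proof. by rewrite /Ex -big_split; apply: eq_bigr => G _; rewrite mulrDr. Qed.

Lemma ExZ p a f : Ex p (fun G => a * f G) = a * Ex p f.
Proof. by rewrite /Ex mulr_sumr; apply: eq_bigr => G _; rewrite mulrCA. Qed.

Lemma ExN p f : Ex p (fun G => - f G) = - Ex p f.
Proof. by rewrite /Ex -sumrN; apply: eq_bigr => G _; rewrite mulrN. Qed.

Lemma ExB p f g : Ex p (fun G => f G - g G) = Ex p f - Ex p g.
Proof. by rewrite ExD ExN. Qed.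

Lemma Ex_sum p (I : Type) (r : seq I) (P : pred I) (F : I -> {set T} -> R) :
  Ex p (fun G => \sum_(i <- r | P i) F i G) = \sum_(i <- r | P i) Ex p (F i).
Proof. by rewrite /Ex exchange_big; apply: eq_bigr => G _; rewrite mulr_sumr. Qed.

Let wt' p e G : R := \prod_(e' | e' != e) (if e' \in G then p e' else 1 - p e').

Let sum_pair e (F : {set T} -> R) :
  \sum_G F G = \sum_(G : {set T} | e \notin G) (F (e |: G) + F G).
Proof.
rewrite (bigID (fun G : {set T} => e \in G)) /= big_split /=; congr (_ + _).
rewrite (reindex_onto (fun G => e |: G) (fun G => G :\ e)) /=; last first.
  by move=> G eG; rewrite setD1K.
apply: eq_bigl => G; rewrite setU11 /=; apply/eqP/idP => [<-|eG].
  by rewrite !inE eqxx.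
by rewrite setU1K.
Qed.

Let wtU p e G : wt p (e |: G) = p e * wt' p e G.
Proof.
rewrite /wt (bigD1 e) //= setU11; congr (_ * _); apply: eq_bigr => e' ne.
by rewrite !inE (negbTE ne).
Qed.

Let wtN p e G : e \notin G -> wt p G = (1 - p e) * wt' p e G.
Proof. by move=> eG; rewrite /wt (bigD1 e) //= (negbTE eG). Qed.

Let Ex_pair p e f :
  Ex p f = \sum_(G : {set T} | e \notin G) wt' p e G * (p e * f (e |: G) + (1 - p e) * f G).
Proof.
rewrite /Ex (sum_pair e); apply: eq_bigr => G eG.
by rewrite wtU (wtN _ eG); ring.
Qed.

Lemma Ex_edge p e f :
  Ex p f = p e * Ex p (fun G => f (e |: G)) + (1 - p e) * Ex p (fun G => f (G :\ e)).
Proof.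
rewrite !(Ex_pair p e) !mulr_sumr -big_split /=; apply: eq_bigr => G eG.
rewrite setU1K // (_ : e |: (e |: G) = e |: G); last by rewrite setUA setUid.
rewrite (_ : G :\ e = G); first by ring.
by apply/setDidPl; rewrite disjoint_sym disjoints1.
Qed.

Lemma Ex_upd p e v f : (forall G, f (e |: G) = f (G :\ e)) -> Ex (upd p e v) f = Ex p f.
Proof.
move=> fe; rewrite !(Ex_pair _ e); apply: eq_bigr => G eG.
have -> : wt' (upd p e v) e G = wt' p e G.
  by apply: eq_bigr => e' ne; rewrite /upd (negbTE ne).
congr (_ * _); rewrite fe (_ : G :\ e = G); first by ring.
by apply/setDidPl; rewrite disjoint_sym disjoints1.
Qed.

Lemma upd_id p e : upd p e (p e) =1 p.
Proof. by move=> e'; rewrite /upd; case: eqP => // ->. Qed.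

Lemma upd_upd p e u v : upd (upd p e u) e v =1 upd p e v.
Proof. by move=> e'; rewrite /upd; case: eqP. Qed.

(** Conditioning on [e]. Setting its probability to 0 shrinks the support by one element, which
    drives the inductions on the support. *)
Lemma Ex_edge0 p e f :
  Ex p f = p e * Ex (upd p e 0) (fun G => f (e |: G)) + (1 - p e) * Ex (upd p e 0) f.
Proof.
rewrite (Ex_edge p e); congr (_ * _ + _ * _).
  by rewrite Ex_upd // => G; congr (f _); apply/setP => x; rewrite !inE; case: eqP.
have u0 : upd p e 0 e = 0 by rewrite /upd eqxx.
rewrite [RHS](Ex_edge _ e) u0 mul0r add0r subr0 mul1r Ex_upd // => G.
by congr (f _); apply/setP => x; rewrite !inE; case: eqP.
Qed.

(** The expectation is affine in each single edge probability, with slope the mean of the discrete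
    derivative. *)
Lemma Ex_edge_diff p e u v f :
  Ex (upd p e v) f - Ex (upd p e u) f =
  (v - u) * Ex (upd p e 0) (fun G => f (e |: G) - f G).
Proof.
rewrite (Ex_edge0 (upd p e v) e) (Ex_edge0 (upd p e u) e) ExB.
have u0 w : upd p e w e = w by rewrite /upd eqxx.
rewrite !(eq_Exl _ (upd_upd _ _ _ _)) !u0; ring.
Qed.

Lemma wt_ge0 p G : isprob p -> 0 <= wt p G.
Proof.
move=> pp; apply: prodr_ge0 => e _; have /andP[p0 p1] := pp e.
by case: ifP => _ //; rewrite subr_ge0.
Qed.

Lemma wt_supp p G e : e \in G -> p e = 0 -> wt p G = 0.
Proof. by move=> eG pe; rewrite /wt (bigD1 e) //= eG pe mul0r. Qed.

Lemma le_Ex p f g : isprob p -> (forall G, f G <= g G) -> Ex p f <= Ex p g.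
Proof. by move=> pp fg; apply: ler_sum => G _; rewrite ler_wpM2l ?wt_ge0. Qed.

Lemma le_Ex_unif E x f g : 0 <= x <= 1 -> (forall G, G \subset E -> f G <= g G) ->
  Ex (unif E x) f <= Ex (unif E x) g.
Proof.
move=> x01 fg; apply: ler_sum => G _.
have [GE|/subsetPn[e eG eE]] := boolP (G \subset E).
  rewrite ler_wpM2l ?fg ?wt_ge0 // => e; rewrite /unif; case: ifP => // _.
  by rewrite lexx ler01.
by rewrite (wt_supp eG) ?mul0r // /unif (negbTE eE).
Qed.

Lemma isprob_unif E x : 0 <= x <= 1 -> isprob (unif E x).
Proof. by move=> x01 e; rewrite /unif; case: ifP => // _; rewrite lexx ler01. Qed.

Lemma isprob_upd p e v : isprob p -> 0 <= v <= 1 -> isprob (upd p e v).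
Proof. by move=> pp v01 e'; rewrite /upd; case: ifP. Qed.

Lemma Ex_supp0 p f : (forall e, p e = 0) -> Ex p f = f set0.
Proof.
move=> p0; rewrite /Ex (bigD1 set0) //= big1 ?addr0 => [|G /set0Pn[e eG]].
  by rewrite /wt big1 ?mul1r // => e _; rewrite inE p0 subr0.
by rewrite (wt_supp eG) ?mul0r.
Qed.

Lemma upd_unif E x e : upd (unif E x) e 0 =1 unif (E :\ e) x.
Proof. by move=> e'; rewrite /upd /unif !inE; case: eqP. Qed.

(** Induction on the support: edges are switched off one by one, down to the measure concentrated on
    the empty set. *)
Lemma supp_ind (P : {set T} -> (T -> R) -> Prop) :
  (forall p, (forall e, p e = 0) -> P set0 p) ->
  (forall E p e, e \in E -> P (E :\ e) (upd p e 0) -> P E p) ->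
  forall E p, (forall e, e \notin E -> p e = 0) -> P E p.
Proof.
move=> P0 PS E; have [m] := ubnP #|E|; elim: m E => // m IH E Em p pE.
have [E0|[e eE]] := set_0Vmem E.
  by rewrite E0; apply: P0 => e; rewrite pE // E0 inE.
apply: (PS _ _ e) => //; apply: IH.
  by move: Em; rewrite (cardsD1 e) eE.
by move=> e'; rewrite /upd !inE negb_and negbK; case: eqP => //= _; apply: pE.
Qed.

Lemma Ex_cst p c : Ex p (fun=> c) = c.
Proof.
pose Q (E : {set T}) q := Ex q (fun=> c) = c.
have H E q : (forall e, e \notin E -> q e = 0) -> Q E q; last first.
  by apply: (H setT) => e; rewrite inE.
apply: (supp_ind (P := Q)) => {p E q} [p p0|E p e _]; rewrite /Q //.
  by rewrite Ex_supp0.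
by rewrite [in X in _ -> X](Ex_edge0 p e) => ->; ring.
Qed.

Lemma Ex_ge0 p f : isprob p -> (forall G, 0 <= f G) -> 0 <= Ex p f.
Proof. by move=> pp f0; rewrite -(Ex_cst p 0); apply: le_Ex. Qed.

(** Raising the probabilities one at a time, each change being nonnegative by [Ex_edge_diff], takes
    the place of a monotone coupling. *)
Lemma Ex_mono p q f : isprob p -> isprob q -> (forall e, p e <= q e) ->
  (forall e G, f G <= f (e |: G)) -> Ex p f <= Ex q f.
Proof.
move=> pp pq le_pq fm.
suff H (Q : {set T}) : forall p, isprob p -> (forall e, p e <= q e) ->
    (forall e, e \notin Q -> p e = q e) -> Ex p f <= Ex q f.
  by apply: (H setT) => // e; rewrite inE.
have [m] := ubnP #|Q|; elim: m Q => // m IH Q Qm {pp le_pq}p pp le_pq pqQ.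
have [Q0|[e eQ]] := set_0Vmem Q.
  by rewrite (eq_Exl (q := q)) // => e; rewrite pqQ // Q0 inE.
have p2q : Ex (upd p e (q e)) f <= Ex q f.
  apply: (IH (Q :\ e)); first by move: Qm; rewrite (cardsD1 e) eQ.
  - exact: isprob_upd.
  - by move=> e'; rewrite /upd; case: eqP => [->|].
  - by move=> e'; rewrite /upd !inE negb_and negbK; case: eqP => [->|] //= _ /pqQ.
apply: le_trans p2q; rewrite -subr_ge0 -(eq_Exl f (upd_id p e)) Ex_edge_diff.
rewrite mulr_ge0 ?subr_ge0 // Ex_ge0 // => [|G]; last by rewrite subr_ge0.
by apply: isprob_upd; rewrite // lexx ler01.
Qed.

(* Lindeberg exchange of the edge probabilities one edge at a time, replacing Russo's formula. *)
Lemma Ex_lindeberg (Q : {set T}) p q f (h : T -> {set T} -> R) : isprob p -> isprob q ->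
  (forall e, p e <= q e) -> (forall e, e \notin Q -> p e = q e) ->
  (forall e G, e \in Q -> f (e |: G) - f G <= h e G) ->
  (forall e e' G, h e G <= h e (e' |: G)) ->
  Ex q f - Ex p f <= \sum_(e in Q) (q e - p e) * Ex q (h e).
Proof.
have [m] := ubnP #|Q|; elim: m Q p => // m IH Q p Qm pp pq le_pq pqQ fh hm.
have [Q0|[e eQ]] := set_0Vmem Q.
  rewrite Q0 big_set0 (eq_Exl (p := p) (q := q)) ?subrr // => e.
  by rewrite pqQ // Q0 inE.
have Qm' : (#|Q :\ e| < m)%N by move: Qm; rewrite (cardsD1 e) eQ.
have := IH (Q :\ e) (upd p e (q e)) Qm' (isprob_upd e pp (pq e)) pq.
have H1 : forall e', upd p e (q e) e' <= q e'.
  by move=> e'; rewrite /upd; case: eqP => [->|].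
have H2 : forall e', e' \notin Q :\ e -> upd p e (q e) e' = q e'.
  by move=> e'; rewrite /upd !inE negb_and negbK; case: eqP => [->|] //= _ /pqQ.
have H3 e' G : e' \in Q :\ e -> f (e' |: G) - f G <= h e' G.
  by rewrite inE => /andP[_]; apply: fh.
move=> /(_ H1 H2 H3 hm) IHe.
rewrite (big_setD1 e) //=.
have -> : Ex q f - Ex p f =
    (Ex (upd p e (q e)) f - Ex (upd p e (p e)) f) + (Ex q f - Ex (upd p e (q e)) f).
  by rewrite (eq_Exl f (upd_id p e)); ring.
apply: lerD.
  rewrite Ex_edge_diff ler_wpM2l ?subr_ge0 //.
  have pu : isprob (upd p e 0) by apply: isprob_upd; rewrite // lexx ler01.
  apply: le_trans (_ : Ex (upd p e 0) (h e) <= _).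
    by apply: le_Ex => // G; apply: fh.
  apply: Ex_mono => // e'; rewrite /upd; case: eqP => [->|] //.
  by have /andP[] := pq e.
apply: le_trans IHe _; apply: ler_sum => e'; rewrite !inE => /andP[ne _].
by rewrite /upd (negbTE ne).
Qed.

(** Split the variance over one edge [e]: the conditional mean [g] given the other edges is still
    [L]-Lipschitz, and [e] itself contributes [v * (1 - v)] times a mean squared increment, at most
    [v * L ^+ 2]. *)
Lemma efron_stein E p f (L : R) : isprob p -> (forall e, e \notin E -> p e = 0) ->
  (forall e G, e \in E -> `|f (e |: G) - f G| <= L) ->
  Ex p (fun G => f G ^+ 2) - Ex p f ^+ 2 <= L ^+ 2 * \sum_(e in E) p e.
Proof.
move=> pp pE; move: pp f; pattern E, p; apply: supp_ind pE => {E p} [p p0|E p e eE IH] pp f fL.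
  by rewrite !Ex_supp0 // subrr big_set0 mulr0.
have /andP[p0 p1] := pp e.
have L0 : 0 <= L by apply: le_trans (fL e set0 eE); rewrite normr_ge0.
set p' := upd p e 0; set v := p e in p0 p1.
have pp' : isprob p' by apply: isprob_upd; rewrite // lexx ler01.
pose g G := v * f (e |: G) + (1 - v) * f G.
have gL e' G : e' \in E :\ e -> `|g (e' |: G) - g G| <= L.
  rewrite inE => /andP[_ e'E].
  have -> : g (e' |: G) - g G =
    v * (f (e' |: (e |: G)) - f (e |: G)) + (1 - v) * (f (e' |: G) - f G).
    by rewrite /g (setUCA [set e]); ring.
  apply: le_trans (ler_normD _ _) _; rewrite !normrM (ger0_norm p0).
  rewrite (ger0_norm (_ : 0 <= 1 - v)) ?subr_ge0 //.
  have -> : L = v * L + (1 - v) * L by ring.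
  by rewrite lerD // ler_wpM2l ?subr_ge0 ?fL.
have := IH pp' g gL.
rewrite [in X in _ -> X](big_setD1 e eE) /= (_ : \sum_(e' in E :\ e) p' e' = \sum_(e' in E :\ e) p e'); last first.
  by apply: eq_bigr => e'; rewrite !inE /p' /upd => /andP[/negbTE ->].
have -> : Ex p f = Ex p' g by rewrite (Ex_edge0 p e) ExD !ExZ.
have -> : Ex p (fun G => f G ^+ 2) =
    Ex p' (fun G => g G ^+ 2) + v * (1 - v) * Ex p' (fun G => (f (e |: G) - f G) ^+ 2).
  rewrite (Ex_edge0 p e) -!ExZ -!ExD; apply: eq_Ex => G; rewrite /g -/v; ring.
move=> IHg.
have H : Ex p' (fun G => (f (e |: G) - f G) ^+ 2) <= L ^+ 2.
  rewrite -[leRHS](Ex_cst p'); apply: le_Ex => // G.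
  by rewrite -real_normK ?num_real // ler_pXn2r ?nnegrE ?fL.
have H' : v * (1 - v) * Ex p' (fun G => (f (e |: G) - f G) ^+ 2) <= v * L ^+ 2.
  apply: le_trans (_ : v * (1 - v) * L ^+ 2 <= _).
    by rewrite ler_wpM2l // mulr_ge0 // subr_ge0.
  by rewrite ler_wpM2r ?sqr_ge0 // -[leRHS]mulr1 ler_wpM2l // gerBl.
rewrite (mulrDr (L ^+ 2)) -[p e]/v (mulrC (L ^+ 2) v).
move: IHg H'; rewrite -/p'; lra.
Qed.

(** The union of two independent random sets again has a product law. Edges are moved one by one
    from [q] into [p], which becomes [r], until [q] vanishes. *)
Lemma Ex_sprinkle p q f :
  Ex p (fun G => Ex q (fun G' => f (G :|: G'))) =
  Ex (fun e => p e + q e - p e * q e) f.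
Proof.
pose Q (E : {set T}) q := forall p, Ex p (fun G => Ex q (fun G' => f (G :|: G'))) =
  Ex (fun e => p e + q e - p e * q e) f.
suff H E q' : (forall e, e \notin E -> q' e = 0) -> Q E q'.
  by apply: (H setT) => e; rewrite inE.
apply: (supp_ind (P := Q)) => {p q E q'} [q q0|E q e _ IH] p.
  rewrite (eq_Exl (q := p)) => [|e]; last by rewrite q0 mulr0 subr0 addr0.
  by apply: eq_Ex => G; rewrite Ex_supp0 // setU0.
set v := q e; set q' := upd q e 0.
pose phi G := Ex q' (fun G' => f (G :|: G')).
pose r := upd p e (p e + v - p e * v).
have -> : Ex p (fun G => Ex q (fun G' => f (G :|: G'))) =
   Ex p (fun G => v * phi (e |: G) + (1 - v) * phi G).
  apply: eq_Ex => G; rewrite (Ex_edge0 q e); congr (_ * _ + _); apply: eq_Ex => G'.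
  by rewrite setUCA setUA.
have -> : Ex p (fun G => v * phi (e |: G) + (1 - v) * phi G) = Ex r phi.
  rewrite (Ex_edge0 p e) (Ex_edge0 r e) !ExD !ExZ.
  rewrite (eq_Exl _ (upd_upd _ _ _ _)) [in RHS](eq_Exl _ (upd_upd _ _ _ _)).
  under eq_Ex do rewrite setUA setUid.
  have -> : r e = p e + v - p e * v by rewrite /r /upd eqxx.
  ring.
rewrite /phi IH; apply: eq_Exl => e'; rewrite /r /q' /upd; case: eqP => [->|] //.
by rewrite mulr0 subr0 addr0.
Qed.

(** The binomial generating function at 1/2, for an exponential Markov bound on the number of edges
    inside a vertex set. *)
Lemma Ex_half_pow E (B : {set T}) x : B \subset E ->
  Ex (unif E x) (fun G => 2^-1 ^+ #|G :&: B|) = (1 - x / 2) ^+ #|B|.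
Proof.
have [m] := ubnP #|B|; elim: m B => // m IH B Bm BE.
have [->|[e eB]] := set_0Vmem B.
  by rewrite cards0 -[RHS](Ex_cst (unif E x)); apply: eq_Ex => G; rewrite setI0 cards0.
have B1 : #|B| = #|B :\ e|.+1 by rewrite (cardsD1 e) eB.
have IHe := IH (B :\ e) _ (subset_trans (subsetDl _ _) BE).
have uE : unif E x e = x by rewrite /unif (fintype.subsetP BE).
rewrite (Ex_edge _ e) uE.
rewrite (eq_Ex _ (g := fun G => 2^-1 * 2^-1 ^+ #|G :&: (B :\ e)|)); last first.
  move=> G; rewrite -exprS; congr (_ ^+ _).
  rewrite (cardsD1 e) !inE eqxx eB add1n; congr _.+1; apply: eq_card => y.
  by rewrite !inE; case: eqP => //= _; rewrite andbF.
rewrite [in X in _ + _ * X](eq_Ex _ (g := fun G => 2^-1 ^+ #|G :&: (B :\ e)|)); last first.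
  by move=> G; congr (_ ^+ _); apply: eq_card => y; rewrite !inE; case: eqP => //= _; rewrite andbF.
rewrite ExZ IHe; last by rewrite -ltnS -B1.
by rewrite B1 exprS; field.
Qed.

End Expectation.

(** * Clusters and cuts *)

Section Clusters.
Variable V : finType.
Implicit Types (G E : {set {set V}}) (S A B W : {set V}) (x y w : V).

Definition adj G : rel V := [rel x y | [set x; y] \in G].
(** Clusters are taken of sets because an exploration carries a whole set of active vertices. *)
Definition reach G S : {set V} := [set y | [exists x in S, connect (adj G) x y]].
Definition gclosed G A := forall x y, adj G x y -> x \in A -> y \in A.

Lemma adj_sym G : symmetric (adj G).
Proof. by move=> x y; rewrite /adj /= setUC. Qed.

Lemma adj_connect_sym G : connect_sym (adj G).
Proof. exact: sym_connect_sym (@adj_sym G). Qed.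

Lemma adjU1 G x y a b :
  adj ([set a; b] |: G) x y = [|| adj G x y, (x == a) && (y == b) | (x == b) && (y == a)].
Proof.
rewrite /adj /= in_setU1 orbC; congr (_ || _); apply/eqP/orP => [H|[]].
- have xI : x \in [set a; b] by rewrite -H set21.
  have yI : y \in [set a; b] by rewrite -H set22.
  have aI : a \in [set x; y] by rewrite H set21.
  have bI : b \in [set x; y] by rewrite H set22.
  move: xI yI aI bI; rewrite !inE.
  case/orP=> /eqP -> /orP[] /eqP ->; rewrite ?eqxx ?orbT ?andbT ?orbb /=; auto.
    by move=> _ /eqP ->; rewrite eqxx; auto.
  by move=> /eqP ->; rewrite eqxx; auto.
- by case/andP=> /eqP -> /eqP ->.
- by case/andP=> /eqP -> /eqP ->; rewrite setUC.
Qed.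

Lemma reach_closed G S : gclosed G (reach G S).
Proof.
move=> x y xy; rewrite !inE => /existsP[z /andP[zS zx]]; apply/existsP; exists z.
by rewrite zS (connect_trans zx) ?connect1.
Qed.

Lemma sub_reach G S : S \subset reach G S.
Proof. by apply/subsetP => x xS; rewrite inE; apply/existsP; exists x; rewrite xS connect0. Qed.

Lemma reach_min G S A : gclosed G A -> S \subset A -> reach G S \subset A.
Proof.
move=> cA /subsetP SA; apply/subsetP => y; rewrite inE => /existsP[x /andP[/SA xA]].
case/connectP=> p; elim: p x xA => [|z p IH] x xA /=; first by move=> _ ->.
by case/andP=> xz; apply: IH; apply: cA xz xA.
Qed.

Lemma sub_gclosed G G' A : G \subset G' -> gclosed G' A -> gclosed G A.
Proof. by move=> /subsetP GG' cA x y /GG'; apply: cA. Qed.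

Lemma reach_mono G G' S : G \subset G' -> reach G S \subset reach G' S.
Proof.
by move=> GG'; apply: reach_min (sub_reach _ _); apply: sub_gclosed GG' (@reach_closed _ _).
Qed.

Lemma reach0 G : reach G set0 = set0.
Proof. by apply/eqP; rewrite -subset0; apply: reach_min => // x y _; rewrite inE. Qed.

(** An edge revealed at an active vertex may be replaced by making its other end active. *)
Lemma reach_edge G S w x : w \in S -> reach ([set w; x] |: G) S = reach G (x |: S).
Proof.
move=> wS; apply/eqP; rewrite eqEsubset; apply/andP; split; apply: reach_min.
- have := sub_reach G (x |: S); rewrite subUset sub1set => /andP[xC /fintype.subsetP/(_ w wS) wC].
  move=> a b; rewrite adjU1 => /or3P[|/andP[_ /eqP ->]|/andP[_ /eqP ->]] //.
  exact: reach_closed.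
- exact: subset_trans (subsetUr _ _) (sub_reach _ _).
- exact: sub_gclosed (subsetUr _ _) (@reach_closed _ _).
- rewrite subUset sub_reach andbT sub1set; apply: (@reach_closed _ _ w).
    by rewrite adjU1 !eqxx /= orbT.
  exact: (fintype.subsetP (sub_reach _ _)).
Qed.

(** Once all neighbours of [w] are active, [w] can be retired: nothing but [w] itself is lost. *)
Lemma reach_drop G S w : w \in S -> (forall y, adj G w y -> y \in S) ->
  reach G S \subset w |: reach G (S :\ w).
Proof.
move=> wS wN; apply: reach_min => [x y xy|]; last first.
  by rewrite -{1}(setD1K wS) setUS // sub_reach.
rewrite !in_setU1 => /orP[/eqP xw|xC]; last by rewrite (reach_closed xy xC) orbT.
have [//|yw] := eqVneq y w; apply: (fintype.subsetP (sub_reach _ _)).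
by rewrite in_setD1 yw wN // -xw.
Qed.

Lemma mem_reach1 G x y : (y \in reach G [set x]) = connect (adj G) x y.
Proof.
rewrite inE; apply/existsP/idP => [[z /andP[]]|xy]; first by rewrite inE => /eqP ->.
by exists x; rewrite inE eqxx.
Qed.

Lemma reach1_sym G x y : (y \in reach G [set x]) = (x \in reach G [set y]).
Proof. by rewrite !mem_reach1 adj_connect_sym. Qed.

Lemma reach1_eq G x y : y \in reach G [set x] -> reach G [set y] = reach G [set x].
Proof.
rewrite mem_reach1 => xy; apply/setP => z; rewrite !mem_reach1.
exact/esym/(same_connect (@adj_connect_sym G)).
Qed.

Lemma pairsP a b : a != b -> [set a; b] \in pairs V.
Proof. by move=> ab; rewrite inE cards2 ab. Qed.

Lemma pairsE e : e \in pairs V -> exists a b, a != b /\ e = [set a; b].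
Proof. by rewrite inE => /cards2P[a [b [ab ->]]]; exists a, b. Qed.

Definition star w B : {set {set V}} := [set [set w; x] | x in B].

Lemma star0 w : star w set0 = set0.
Proof. exact: imset0. Qed.

Lemma star_setD1 E w B x : x \in B ->
  (E :\ [set w; x]) :\: star w (B :\ x) = E :\: star w B.
Proof.
by move=> xB; rewrite setDDl /star -{2}(setD1K xB) imsetU1.
Qed.

(** * Cluster exploration *)

Section Exploration.
Variable R : realFieldType.

(* Reveal one by one the pairs joining [w] to [B]: the number of new cluster vertices is binomial,
   whose generating function is [(1 - p + p * al) ^+ #|B|]. *)
Lemma explore_star (p al a b : R) (h : {set V} -> R) w B S E :
  0 <= p <= 1 -> w \in S -> [disjoint S & B] -> star w B \subset E ->
  (forall B', B' \subset B ->
     Ex (unif (E :\: star w B) p) (fun G => h (reach G (S :|: B'))) <= b + a * al ^+ #|B'|) ->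
  Ex (unif E p) (fun G => h (reach G S)) <= b + a * (1 - p + p * al) ^+ #|B|.
Proof.
move=> /andP[p0 p1]; have [m] := ubnP #|B|.
elim: m B S E a => // m IH B S E a Bm wS SB wE H.
have [B0|[x xB]] := set_0Vmem B.
  have := H set0 (sub0set _); rewrite B0 star0 setD0 cards0 expr0.
  by under eq_Ex do rewrite setU0.
have cB : #|B| = #|B :\ x|.+1 by rewrite (cardsD1 x) xB.
have eE : [set w; x] \in E by apply: (fintype.subsetP wE); apply/imsetP; exists x.
have Bm' : (#|B :\ x| < m)%N by rewrite -ltnS -cB.
have xS : x \notin S by apply: contraL xB => xS; rewrite (disjointFr SB xS).
have xw : x != w by apply: contraNneq xS => ->.
have wE' : star w (B :\ x) \subset E :\ [set w; x].
  apply/fintype.subsetP => _ /imsetP[y /setD1P[yx yB] ->]; rewrite in_setD1.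
  rewrite (fintype.subsetP wE) ?andbT; last by apply/imsetP; exists y.
  apply/eqP => /setP/(_ y); rewrite !inE eqxx orbT (negbTE yx) orbF => /esym/eqP yw.
  by move: SB yB; rewrite yw => SB; rewrite (disjointFr SB wS).
rewrite (Ex_edge0 _ [set w; x]) !(eq_Exl _ (upd_unif _ _ _)).
have uE : unif E p [set w; x] = p by rewrite /unif eE.
rewrite uE; under eq_Ex do rewrite reach_edge //.
(* If the edge is present, [x] becomes active and the coefficient gains a factor [al]; if it is
   absent, both stay as they are. *)
have H1 := IH (B :\ x) (x |: S) (E :\ [set w; x]) (a * al) Bm'.
have H2 := IH (B :\ x) S (E :\ [set w; x]) a Bm' wS.
rewrite star_setD1 // in H1 H2.
set t := (1 - p + p * al) ^+ #|B :\ x| in H1 H2.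
have {}H1 : Ex (unif (E :\ [set w; x]) p) (fun G => h (reach G (x |: S))) <= b + a * al * t.
  apply: H1 => //; first by rewrite in_setU1 wS orbT.
    rewrite disjoints_subset subUset sub1set !inE eqxx /= -disjoints_subset.
    by apply: disjointWr SB; apply: subsetDl.
  move=> B' B'B; have := H (x |: B').
  rewrite subUset sub1set xB (subset_trans B'B (subsetDl _ _)) => /(_ isT).
  have -> : #|x |: B'| = #|B'|.+1.
    rewrite cardsU1; case: (boolP (x \in B')) => [/(fintype.subsetP B'B)|//].
    by rewrite !inE eqxx.
  rewrite exprS mulrA; congr (_ <= _); apply: eq_Ex => G.
  by rewrite setUA [S :|: _]setUC.
have {}H2 : Ex (unif (E :\ [set w; x]) p) (fun G => h (reach G S)) <= b + a * t.
  apply: H2 => //; first by apply: disjointWr SB; apply: subsetDl.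
  by move=> B' B'B; apply: H; apply: subset_trans B'B (subsetDl _ _).
rewrite cB exprS -/t.
have -> : b + a * ((1 - p + p * al) * t) = p * (b + a * al * t) + (1 - p) * (b + a * t) by ring.
by rewrite lerD // ler_wpM2l // subr_ge0.
Qed.

(* [(1 - x) ^+ #|S|] is a supermartingale along the exploration, as long as [m] vertices remain. *)
Lemma reach_lower (p x : R) m k W E S : 0 <= p <= 1 -> 0 <= x <= 1 ->
  (1 - p * x) ^+ m <= 1 - x ->
  {in W &, forall a b, a != b -> [set a; b] \in E} -> S \subset W -> (m + 2 * k <= #|W|)%N ->
  Ex (unif E p) (fun G => (#|reach G S :&: W| < k)%N%:R) <= (1 - x) ^+ #|S|.
Proof.
move=> p01 /andP[x0 x1] Hm; have /andP[p0 p1] := p01.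
elim: k W E S => [|k IH] W E S WE SW Wk.
  rewrite (eq_Ex _ (g := fun=> 0)) // Ex_cst exprn_ge0 ?subr_ge0 //.
have [Sk|Sk] := leqP k.+1 #|S|.
  rewrite (eq_Ex _ (g := fun=> 0)) ?Ex_cst ?exprn_ge0 ?subr_ge0 // => G.
  rewrite ltnNge (leq_trans Sk) // subset_leq_card // subsetI SW andbT; exact: sub_reach.
have [->|[w wS]] := set_0Vmem S.
  rewrite cards0 expr0 -[leRHS](Ex_cst (unif E p)); apply: le_Ex => [|G].
    exact: isprob_unif.
  by rewrite lern1 leq_b1.
have wW := fintype.subsetP SW _ wS.
have cS : #|S| = #|S :\ w|.+1 by rewrite (cardsD1 w) wS.
(* At most [k] active vertices, against [m + 2 * k.+1] vertices of [W], leave at least [m] to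
   reveal. *)
have cWS : (m <= #|W :\: S|)%N.
  by rewrite cardsDS //; lia.
have q0 : 0 <= 1 - p * x by rewrite subr_ge0 mulr_ile1.
have q1 : 1 - p * x <= 1 by rewrite gerBl mulr_ge0.
have -> : (1 - x) ^+ #|S| = 0 + (1 - x) ^+ #|S :\ w| * (1 - x) by rewrite cS exprSr add0r.
apply: le_trans (_ : 0 + (1 - x) ^+ #|S :\ w| * (1 - p + p * (1 - x)) ^+ #|W :\: S| <= _);
  last first.
  rewrite !add0r ler_wpM2l ?exprn_ge0 ?subr_ge0 //.
  have -> : 1 - p + p * (1 - x) = 1 - p * x by ring.
  by apply: le_trans Hm; apply: ler_wiXn2l.
apply: (explore_star (h := fun C => (#|C :&: W| < k.+1)%N%:R) p01 wS) => //.
- by rewrite disjoint_sym; apply/setDidPl; rewrite setDDl setUid.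
- apply/fintype.subsetP => _ /imsetP[y /setDP[yW yS] ->]; apply: WE => //.
  by apply: contraNneq yS => <-.
move=> B' B'W; rewrite add0r.
have cU : #|(S :|: B') :\ w| = (#|S :\ w| + #|B'|)%N.
  have wB : w \notin B' by apply: contraL wS => /(fintype.subsetP B'W)/setDP[].
  rewrite setDUl (_ : B' :\ w = B'); last first.
    by apply/setDidPl; rewrite disjoint_sym disjoints1.
  rewrite cardsU (_ : _ :&: B' = set0) ?cards0 ?subn0 //.
  apply/eqP; rewrite -subset0; apply/fintype.subsetP => y; rewrite !inE => /andP[/andP[_ yS]].
  by move/(fintype.subsetP B'W)/setDP => [_]; rewrite yS.
rewrite -exprD -cU.
(* The vertex [w] is retired: it leaves [W], counts as found, and lowers the target by one. *)
apply: le_trans (IH (W :\ w) (E :\: star w (W :\: S)) _ _ _ _).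
- apply: le_Ex => [|G]; first exact: isprob_unif.
  rewrite ler_nat; case: (ltnP _ k.+1) => // lt; rewrite (_ : (_ < k)%N = true) //.
  have wC : w \in reach G (S :|: B') :&: W.
    by rewrite inE wW andbT (fintype.subsetP (sub_reach _ _)) // inE wS.
  move: lt; rewrite (cardsD1 w) wC ltnS; apply: leq_ltn_trans; apply: subset_leq_card.
  apply/fintype.subsetP => y; rewrite in_setI !in_setD1 in_setI => /and3P[yC -> ->]; rewrite andbT /=.
  apply: fintype.subsetP yC; apply: reach_min (@reach_closed _ _) _.
  exact: subset_trans (subsetDl _ _) (sub_reach _ _).
- move=> a b /setD1P[aw aW] /setD1P[bw bW] ab; rewrite in_setD WE // andbT.
  apply/imsetP => -[y _ /setP/(_ w)]; rewrite !inE eqxx /= => /orP[]/eqP.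
    by move/eqP: aw => aw /esym.
  by move/eqP: bw => bw /esym.
- apply/fintype.subsetP => y; rewrite !inE => /andP[-> /orP[/(fintype.subsetP SW)//|]].
  by move/(fintype.subsetP B'W)/setDP => [].
- by move: Wk; rewrite (cardsD1 w W) wW; clear; lia.
Qed.

(* Along the exploration [1 - be ^+ #|S|] loses in expectation [g * be ^+ (#|S| - 1)] per step,
   which pays for [de] until [#|S|] reaches [H], where the bound exceeds 1. *)
Lemma reach_upper (p be g de : R) H k E S : 0 <= p <= 1 -> 0 < be <= 1 -> be ^+ H < 1 ->
  0 <= g -> be + g <= (1 - p + p * be) ^+ #|V| -> 0 <= de <= g * be ^+ H -> k%:R * de <= 1 ->
  Ex (unif E p) (fun G => (k <= #|reach G S|)%N%:R) <=
  (1 - be ^+ #|S|) / (1 - be ^+ H) + 1 - k%:R * de.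
Proof.
move=> p01 /andP[be0 be1] bH g0 Hg /andP[de0 de1]; have /andP[p0 p1] := p01.
have F0 : 0 < 1 - be ^+ H by rewrite subr_gt0.
have le1 E' h : Ex (unif E' p) (fun G => (h G : bool)%:R) <= 1.
  rewrite -[leRHS](Ex_cst (unif E' p)); apply: le_Ex => [|G]; first exact: isprob_unif.
  by rewrite lern1 leq_b1.
elim: k E S => [|k IH] E S kde.
  rewrite mul0r subr0; apply: le_trans (le1 _ _) _.
  rewrite lerDr; apply: divr_ge0; last exact: ltW.
  by rewrite subr_ge0 exprn_ile1 // ltW.
have [HS|SH] := leqP H #|S|.
  apply: le_trans (le1 _ _) _; rewrite -addrA ler_wpDr ?subr_ge0 //.
  by rewrite ler_pdivlMr // mul1r lerB // ler_wiXn2l // ltW.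
have [->|[w wS]] := set_0Vmem S.
  rewrite cards0 expr0 subrr mul0r add0r (eq_Ex _ (g := fun=> 0)).
    by rewrite Ex_cst subr_ge0.
  by move=> G; rewrite reach0 cards0.
have cS : #|S| = #|S :\ w|.+1 by rewrite (cardsD1 w) wS.
set s := #|S :\ w| in cS.
pose B := [set x | (x \notin S) && ([set w; x] \in E)].
set F := 1 - be ^+ H in F0 *.
have kde' : k%:R * de <= 1.
  by apply: le_trans kde; rewrite ler_wpM2r // ler_nat.
(* The coefficient of the generating function is negative, so a lower bound on that function
   suffices; [Hg] passes from [#|V|] to [#|B|] because the base is at most 1. *)
apply: le_trans (_ : (F^-1 + 1 - k%:R * de) + (- (be ^+ s / F)) * (1 - p + p * be) ^+ #|B| <= _).
  apply: (explore_star (h := fun C => (k < #|C|)%N%:R) p01 wS).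
  - by rewrite disjoints_subset; apply/fintype.subsetP => y yS; rewrite !inE yS.
  - by apply/fintype.subsetP => _ /imsetP[y /[!inE] /andP[_ yE] ->].
  move=> B' B'B.
  have cU : #|(S :|: B') :\ w| = (s + #|B'|)%N.
    have wB : w \notin B' by apply: contraL wS => /(fintype.subsetP B'B); rewrite inE => /andP[].
    rewrite setDUl (_ : B' :\ w = B'); last first.
      by apply/setDidPl; rewrite disjoint_sym disjoints1.
    rewrite cardsU (_ : _ :&: B' = set0) ?cards0 ?subn0 //.
    apply/eqP; rewrite -subset0; apply/fintype.subsetP => y; rewrite !inE => /andP[/andP[_ yS]].
    by move/(fintype.subsetP B'B); rewrite inE yS.
  apply: le_trans (_ : (1 - be ^+ #|(S :|: B') :\ w|) / F + 1 - k%:R * de <= _); last first.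
    by rewrite cU exprD le_eqVlt; apply/orP; left; apply/eqP; ring.
  apply: le_trans (IH (E :\: star w B) _ kde').
  apply: le_Ex_unif => // G GE; rewrite ler_nat.
  case: (ltnP k _) => //= lt; rewrite (_ : (k <= _)%N = true) // -ltnS.
  apply: leq_trans lt _; apply: leq_trans (subset_leq_card (reach_drop (w := w) _ _)) _.
  - by rewrite inE wS.
  - move=> y /(fintype.subsetP GE); rewrite !inE => /andP[ynB yE].
    apply: contraNT ynB; rewrite negb_or => /andP[yS _]; apply/imsetP; exists y => //.
    by rewrite inE yS.
  - by rewrite cardsU1; case: (_ \notin _).
have q1 : 0 <= 1 - p + p * be <= 1.
  by apply/andP; split; nra.
have /andP[q10 q11] := q1.
have HB : be + g <= (1 - p + p * be) ^+ #|B|.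
  by apply: le_trans Hg _; apply: ler_wiXn2l => //; apply: max_card.
have bs : be ^+ H <= be ^+ s.
  have sH : (s <= H)%N by move: SH; rewrite cS => /ltnW/ltnW.
  by apply: ler_wiXn2l sH => //; apply: ltW.
have F1 : 1 <= F^-1 by rewrite invf_ge1 // gerBl exprn_ge0 // ltW.
have bs0 : 0 <= be ^+ s by rewrite exprn_ge0 // ltW.
have H1 : be ^+ s / F * (be + g) <= be ^+ s / F * (1 - p + p * be) ^+ #|B|.
  by rewrite ler_wpM2l // divr_ge0 // ltW.
have H2 : de <= be ^+ s / F * g.
  apply: le_trans de1 _; rewrite mulrC ler_wpM2r //; apply: le_trans bs _.
  by rewrite ler_peMr.
rewrite cS exprSr -natr1 mulrBl (mulrAC (be ^+ s)) div1r.
by clear -H1 H2; lra.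
Qed.

End Exploration.

(** * Vertices in large clusters *)

Definition bigv K G : {set V} := [set u | (K <= #|reach G [set u]|)%N].

Lemma bigv_mono K G e : bigv K G \subset bigv K (e |: G).
Proof.
apply/fintype.subsetP => u; rewrite !inE => /leq_trans; apply; apply: subset_leq_card.
exact: reach_mono (subsetUr _ _).
Qed.

Lemma reach_edge_far G u a b : u \notin reach G [set a] -> u \notin reach G [set b] ->
  reach ([set a; b] |: G) [set u] = reach G [set u].
Proof.
move=> ua ub; apply/eqP; rewrite eqEsubset (reach_mono [set u] (subsetUr _ G)) andbT.
apply: reach_min (sub_reach _ _) => x y; rewrite adjU1 => /or3P[|/andP[/eqP-> _]|/andP[/eqP-> _]].
- exact: reach_closed.
- by rewrite reach1_sym (negbTE ua).
- by rewrite reach1_sym (negbTE ub).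
Qed.

(** A vertex that becomes large lies in the old cluster of [a] or of [b], and that cluster had fewer
    than [K] vertices. *)
Lemma bigv_lip K G a b : (#|bigv K ([set a; b] |: G)| <= #|bigv K G| + 2 * K)%N.
Proof.
pose D x := if (#|reach G [set x]| < K)%N then reach G [set x] else set0.
have cD x : (#|D x| <= K)%N by rewrite /D; case: ltnP => [/ltnW|]; rewrite ?cards0.
apply: (@leq_trans #|bigv K G :|: (D a :|: D b)|); last first.
  apply: leq_trans (leq_card_setU _ _) _; rewrite leq_add2l.
  by apply: leq_trans (leq_card_setU _ _) _; rewrite mul2n -addnn leq_add.
apply/subset_leq_card/fintype.subsetP => u uK; rewrite in_setU.
have [//|uN] := boolP (u \in bigv K G); rewrite /= in_setU.
have D_u x : u \in reach G [set x] -> u \in D x.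
  by move=> ux; rewrite /D -(reach1_eq ux) ltnNge; move: uN; rewrite inE => -> /=;
     rewrite (reach1_eq ux).
have [/D_u -> //|ua] := boolP (u \in reach G [set a]).
have [/D_u ->|ub] := boolP (u \in reach G [set b]); first by rewrite orbT.
by move: uK uN; rewrite !inE reach_edge_far // => ->.
Qed.

(** * The distance from bipartiteness as a minimum over cuts *)

Definition bad A : {set {set V}} :=
  [set e | [exists x, [exists y, (e == [set x; y]) && ((x \in A) == (y \in A))]]].

Lemma bad_edge A x y : ([set x; y] \in bad A) = ((x \in A) == (y \in A)).
Proof.
rewrite inE; apply/existsP/idP => [[u /existsP[v /andP[/eqP xy uv]]]|xyA]; last first.
  by exists x; apply/existsP; exists y; rewrite eqxx.
have xI : x \in [set u; v] by rewrite -xy set21.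
have yI : y \in [set u; v] by rewrite -xy set22.
by move: xI yI; rewrite !inE => /orP[]/eqP -> /orP[]/eqP ->; rewrite // eq_sym.
Qed.

(** With [dist_bp_ex], this makes [dist_bp G] the minimum of [#|G :&: bad A|] over all cuts [A]. A
    singleton, read as a loop, is bad for every [A]. *)
Lemma dist_bp_le G A : (dist_bp G <= #|G :&: bad A|)%N.
Proof.
apply: (dist_bpP G).2; rewrite /makes_bipartite subsetIl /=; apply/existsP; exists A.
apply/forallP => x; apply/forallP => y; apply/implyP; rewrite in_setD in_setI bad_edge.
by rewrite negb_and; case/andP=> /orP[/negP//|].
Qed.

Lemma dist_bp_ex G : exists A, dist_bp G = #|G :&: bad A|.
Proof.
have [[F /andP[FG /existsP[A HA]] Fd] _] := dist_bpP G; exists A; apply/eqP.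
have H : (#|G :&: bad A| <= #|F|)%N.
  apply/subset_leq_card/fintype.subsetP => e /setIP[eG]; rewrite inE.
  case/existsP=> x /existsP[y /andP[/eqP exy xyA]]; rewrite exy in eG *.
  move/forallP/(_ x)/forallP/(_ y): HA; rewrite xyA implybF in_setD eG andbT negbK.
  by [].
by rewrite eqn_leq dist_bp_le -Fd H.
Qed.

Lemma dist_bp_mono G G' : G \subset G' -> (dist_bp G <= dist_bp G')%N.
Proof.
have [A ->] := dist_bp_ex G' => GG'; apply: leq_trans (dist_bp_le G A) _.
by apply: subset_leq_card; apply: setSI.
Qed.

Lemma dist_bpU1 G e : (dist_bp (e |: G) <= (dist_bp G).+1)%N.
Proof.
have [A ->] := dist_bp_ex G; apply: leq_trans (dist_bp_le _ A) _.
apply: leq_trans (subset_leq_card (_ : _ \subset e |: (G :&: bad A))) _.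
  by apply/fintype.subsetP => f; rewrite !in_setI !in_setU1 in_setI => /andP[/orP[->|->] ->] //; rewrite orbT.
by rewrite cardsU1 -[X in (_ <= X)%N]add1n leq_add2r leq_b1.
Qed.

Lemma dist_bp0 : dist_bp (set0 : {set {set V}}) = 0%N.
Proof. by have [A ->] := dist_bp_ex set0; rewrite set0I cards0. Qed.

(* If the endpoints lie in different clusters, flipping one side of an optimal cut along the cluster
   of [a] makes the new edge cross. *)
Lemma dist_bp_pivot G a b : b \notin reach G [set a] -> dist_bp ([set a; b] |: G) = dist_bp G.
Proof.
move=> bC; apply/eqP; rewrite eqn_leq (dist_bp_mono (subsetUr _ G)) andbT.
have [A ->] := dist_bp_ex G; set e := [set a; b].
have sub_bad A' : e \notin bad A' -> G :&: bad A' \subset G :&: bad A ->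
    (dist_bp (e |: G) <= #|G :&: bad A|)%N.
  move=> eA' sA'; apply: leq_trans (dist_bp_le _ A') _.
  rewrite setIUl; apply: leq_trans (subset_leq_card sA'); apply: subset_leq_card.
  by rewrite subUset subxx andbT; apply/fintype.subsetP => f; rewrite in_setI in_set1 => /andP[/eqP ->]; rewrite (negbTE eA').
have [eA|/sub_bad] := boolP (e \in bad A); last exact.
pose A' := [set x | (x \in A) (+) (x \in reach G [set a])].
have mA' z : (z \in A') = (z \in A) (+) (z \in reach G [set a]) by rewrite inE.
apply: (sub_bad A').
  have aC : a \in reach G [set a] by rewrite (fintype.subsetP (sub_reach _ _)) // inE.
  by move: eA; rewrite !bad_edge !mA' aC (negbTE bC) addbT addbF => /eqP ->; case: (b \in A).
apply/fintype.subsetP => f /setIP[fG fA']; rewrite in_setI fG /=.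
move: (fA') fG; rewrite {1}inE => /existsP[x /existsP[y /andP[/eqP fxy _]]] fG.
move: fA'; rewrite fxy !bad_edge !mA'.
have xy : adj G x y by rewrite /adj /= -fxy.
have -> : (x \in reach G [set a]) = (y \in reach G [set a]).
  by apply/idP/idP; apply: reach_closed; rewrite // adj_sym.
by case: (x \in A); case: (y \in A); case: (y \in reach _ _).
Qed.

End Clusters.

(** * Vertex orderings and an encoding of cuts *)

Section Ordering.
Local Open Scope nat_scope.

Fixpoint chg (a : bool) (l : seq bool) : nat :=
  if l is b :: l' then (a != b) + chg b l' else 0.
Definition chgs l := if l is a :: l' then chg a l' else 0.

Lemma chg_cat a l1 l2 : chg a (l1 ++ l2) = chg a l1 + chg (last a l1) l2.
Proof. by elim: l1 a => //= b l1 IH a; rewrite IH addnA. Qed.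

Lemma chg_head a b l : chg a l <= (a != b) + chg b l.
Proof. by by case: l => //= c l; case: a; case: b; case: c => /=; lia. Qed.

(** An entry inserted right after [x] is invisible if it equals [x]; otherwise it creates at most
    two changes. *)
Lemma chgs_insert l1 x y l2 :
  chgs (l1 ++ x :: y :: l2) <= chgs (l1 ++ x :: l2) + 2 * (x != y).
Proof.
have H : (x != y) + chg y l2 <= chg x l2 + 2 * (x != y).
  by have := chg_head y x l2; rewrite (eq_sym y x); lia.
case: l1 => [|a l1] /=; first by [].
by rewrite !chg_cat /=; lia.
Qed.

Lemma chgs_cat l1 l2 : chgs (l1 ++ l2) <= chgs l1 + chgs l2 + 1.
Proof.
case: l1 => [|a l1] /=; first by rewrite leq_addr.
rewrite chg_cat; case: l2 => [|b l2] /=; first by lia.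
by have := leq_b1 (last a l1 != b); lia.
Qed.

Lemma chgsE l : chgs l =
  count (fun j => nth false l j != nth false l j.+1) (iota 0 (size l).-1).
Proof.
case: l => //= a l; elim: l a => //= b l IH a; congr (_ + _).
by rewrite IH (iotaDl 1 0) count_map; apply: eq_count.
Qed.

Definition flat b (l : seq bool) i :=
  all (fun j => nth false l j == nth false l (i * b)) (iota (i * b) b).

(** A block that is not constant contains a change between two of its own positions, and the blocks
    are disjoint. *)
Lemma count_not_flat b l N : N * b <= size l ->
  count (fun i => ~~ flat b l i) (iota 0 N) <= chgs l.
Proof.
move=> Nb; rewrite chgsE -!size_filter.
set s1 := filter _ (iota 0 N); set s2 := filter _ (iota 0 _).
rewrite -(size_map (fun j => j %/ b) s2); apply: uniq_leq_size.
  by rewrite filter_uniq ?iota_uniq.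
move=> i; rewrite mem_filter mem_iota /= add0n => /andP[nf iN].
have [b0|b0] := posnP b; first by move: nf; rewrite /flat b0.
have iNb : i.+1 * b <= size l by apply: leq_trans Nb; rewrite leq_mul2r iN orbT.
(* Both [j] and [j.+1] must lie in the block, hence the length [b.-1]. *)
have [/hasP[j jI jc]|/hasPn nc] :=
  boolP (has (fun j => nth false l j != nth false l j.+1) (iota (i * b) b.-1)).
  apply/mapP; exists j.
    rewrite mem_filter jc mem_iota /= add0n; move: jI iNb; rewrite mem_iota mulSn; lia.
  by move: jI; rewrite mem_iota => /andP[j1 j2]; apply/esym/eqP;
     rewrite eqn_leq -ltnS ltn_divLR // leq_divRL // j1 mulSn andbT; lia.
case/negP: nf; apply/allP => j; rewrite mem_iota => /andP[j1 j2].
rewrite -(subnKC j1); have : j - i * b < b by lia.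
elim: (j - i * b) => [|t IH] tb; first by rewrite addn0.
rewrite -(eqP (IH (ltnW tb))) addnS eq_sym; apply: contraTT isT => ch.
by move: (nc (i * b + t)); rewrite mem_iota ch /=; apply; lia.
Qed.

Variable V : finType.
Implicit Types (G : {set {set V}}) (A W Z : {set V}) (v : seq V) (chi : V -> bool).

(** The cut [A] relative to [chi]: along an edge that [chi] colours properly, it changes exactly
    when the edge is in [bad A]. *)
Definition rho A chi x := (x \in A) (+) chi x.
Definition viol G A W := #|[set e in G :&: bad A | e \subset W]|.

(** Grow the list from [u]. A new vertex [y] is inserted just after a listed neighbour [x] and
    coloured against it, so it can cost two changes only if [xy] is violated; as [y] is new, that
    edge was not counted before. *)
Lemma order_reach G u m : m < #|reach G [set u]| ->
  exists v chi, [/\ uniq v, size v = m.+1, {subset v <= reach G [set u]}, u \in v &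
    forall A, chgs (map (rho A chi) v) <= 2 * viol G A [set x in v]].
Proof.
elim: m => [_|m IH mC].
  exists [:: u], xpred0; split=> //; last exact: mem_head.
  by move=> x; rewrite inE => /eqP ->; apply: (fintype.subsetP (sub_reach _ _)); rewrite inE.
have [v [chi [uv sv vC uV Hv]]] := IH (ltnW mC).
set W := [set x in v].
have cW : #|W| = m.+1 by rewrite cardsE (card_uniqP uv).
have [x [y [xv yv xy]]] : exists x y, [/\ x \in v, y \notin v & adj G x y].
  have [/existsP[x /existsP[y /and3P[xv yv xy]]]|H] :=
    boolP [exists x, exists y, [&& x \in v, y \notin v & adj G x y]]; first by exists x, y.
  have : reach G [set u] \subset W.
    apply: reach_min; last by rewrite sub1set inE.
    move=> x y xy; rewrite !inE => xv; apply: contraNT H => yv.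
    by apply/existsP; exists x; apply/existsP; exists y; rewrite xv yv.
  by move/subset_leq_card; rewrite cW leqNgt mC.
have yC : y \in reach G [set u] by apply: reach_closed xy (vC _ xv).
have [v1 [v2 vE]] : exists v1 v2, v = v1 ++ x :: v2.
  by case/splitPr: xv => v1 v2; exists v1, v2.
(* [y] is a new neighbour of [x], given the colour opposite to that of [x]. *)
pose v' := v1 ++ x :: y :: v2; pose chi' z := if z == y then ~~ chi x else chi z.
have pv : perm_eq v' (y :: v).
  by rewrite vE /v'; apply/permP => a; rewrite /= !count_cat /=; lia.
exists v', chi'; split.
- by rewrite (perm_uniq pv) /= yv.
- by rewrite (perm_size pv) /= sv.
- by move=> z; rewrite (perm_mem pv) inE => /orP[/eqP ->|/vC].
- by rewrite (perm_mem pv) inE uV orbT.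
move=> A.
have eq_map s : {subset s <= v} -> map (rho A chi') s = map (rho A chi) s.
  move=> sv'; apply/eq_in_map => z /sv' zv; rewrite /rho /chi'.
  by case: eqP => // zy; rewrite zy (negbTE yv) in zv.
have -> : map (rho A chi') v' =
    map (rho A chi) v1 ++ rho A chi x :: rho A chi' y :: map (rho A chi) v2.
  rewrite /v' map_cat /= !eq_map //; first last.
  - by move=> z zv; rewrite vE mem_cat zv.
  - by move=> z zv; rewrite vE mem_cat inE zv !orbT.
  by congr (_ ++ _ :: _); rewrite /rho /chi'; case: eqP => // xy'; rewrite xy' (negbTE yv) in xv.
apply: leq_trans (chgs_insert _ _ _ _) _.
have := Hv A; rewrite {1}vE map_cat /= -/W => cle.
suff le_viol : viol G A W + (rho A chi x != rho A chi' y) <= viol G A [set z in v'].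
  apply: leq_trans (leq_mul (leqnn 2) le_viol); rewrite mulnDr.
  by rewrite leq_add2r.
have rxy : (rho A chi x != rho A chi' y) = ([set x; y] \in bad A).
  by rewrite bad_edge /rho /chi' eqxx; do 2!case: (_ \in A); case: (chi x).
rewrite rxy /viol; set E1 := [set e in _ | _].
have xyW : [set x; y] \notin E1.
  by rewrite inE negb_and subUset !sub1set /W !inE (negbTE yv) !andbF orbT.
have W'E z : (z \in [set z in v']) = (z == y) || (z \in W).
  by rewrite !inE (perm_mem pv) inE.
case: (boolP (_ \in bad A)) => bxy /=; last first.
  rewrite addn0; apply/subset_leq_card/fintype.subsetP => e; rewrite !inE.
  case/andP=> -> /= /fintype.subsetP eW; apply/fintype.subsetP => z /eW zW.
  by rewrite W'E zW orbT.
have -> : (#|E1| + 1 = #|[set x; y] |: E1|)%N by rewrite cardsU1 xyW addnC.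
have xyG : [set x; y] \in G by [].
apply/subset_leq_card/fintype.subsetP => e; rewrite in_setU1 => /orP[/eqP ->|].
  by rewrite inE in_setI xyG bxy subUset !sub1set !W'E eqxx /W inE xv orbT.
rewrite !inE => /andP[-> /= /fintype.subsetP eW]; apply/fintype.subsetP => z /eW zW.
by rewrite W'E zW orbT.
Qed.

(** Concatenate the lists of the clusters in [Z]. Each junction adds at most one change, and there
    are at most [#|Z| / s] clusters; multiplying by [s] avoids the quotient. *)
Lemma order_big G s Z : {in Z, forall x, reach G [set x] \subset Z} -> Z \subset bigv s G ->
  exists v chi, [/\ uniq v, v =i Z &
    forall A, s * chgs (map (rho A chi) v) <= 2 * s * viol G A Z + #|Z|].
Proof.
have [m] := ubnP #|Z|; elim: m Z => // m IH Z Zm Zc Zs.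
have [->|[u uZ]] := set_0Vmem Z.
  by exists [::], xpred0; split=> [||A] //; [move=> x; rewrite inE|rewrite /= muln0].
set C := reach G [set u].
have uC : u \in C by rewrite (fintype.subsetP (sub_reach _ _)) // inE.
have sC : s <= #|C| by move/(fintype.subsetP Zs): uZ; rewrite inE.
have CZ : C \subset Z by apply: Zc.
have C0 : 0 < #|C| by apply/card_gt0P; exists u.
(* With [m] one below the size of [C], the list exhausts the cluster. *)
have [v1 [chi1 [uv1 sv1 v1C _ H1]]] := order_reach (G := G) (u := u) (m := #|C|.-1) ltac:(by rewrite ltn_predL).
have v1E : v1 =i C.
  apply/subset_cardP; last exact/fintype.subsetP.
  by rewrite (card_uniqP uv1) sv1 prednK.
have cZ : #|Z| = #|C| + #|Z :\: C| by rewrite cardsD (setIidPr CZ) subnKC // subset_leq_card.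
have [|x /setDP[xZ xC]||v2 [chi2 [uv2 v2E H2]]] := IH (Z :\: C).
- by rewrite -ltnS; apply: leq_trans Zm; rewrite cZ; lia.
- apply/fintype.subsetP => y yx; rewrite inE (fintype.subsetP (Zc _ xZ)) // andbT.
  by apply: contra xC => yC; rewrite /C -(reach1_eq yC) reach1_sym.
- exact: subset_trans (subsetDl _ _) Zs.
pose chi z := if z \in C then chi1 z else chi2 z.
exists (v1 ++ v2), chi; split.
- rewrite cat_uniq uv1 uv2 andbT /=; apply/hasPn => z; rewrite v2E inE => /andP[zC _].
  by rewrite /= v1E.
- move=> z; rewrite mem_cat v1E v2E in_setD.
  by have [/(fintype.subsetP CZ) ->|] := boolP (z \in C).
move=> A; rewrite map_cat.
have -> : map (rho A chi) v1 = map (rho A chi1) v1.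
  by apply/eq_in_map => z; rewrite v1E /rho /chi => ->.
have -> : map (rho A chi) v2 = map (rho A chi2) v2.
  by apply/eq_in_map => z; rewrite v2E /rho /chi in_setD => /andP[/negbTE ->].
have := chgs_cat (map (rho A chi1) v1) (map (rho A chi2) v2).
have := H1 A; have := H2 A.
have -> : [set x in v1] = C by apply/setP => z; rewrite inE v1E.
have vd : viol G A C + viol G A (Z :\: C) <= viol G A Z.
  rewrite /viol -[X in X <= _]cardsUI -[leqRHS]addn0; apply: leq_add.
    apply/subset_leq_card/fintype.subsetP => e; rewrite !inE.
    case/orP=> /andP[-> /= H]; apply: subset_trans H _ => //; exact: subsetDl.
  rewrite leqn0 cards_eq0 -subset0; apply/fintype.subsetP => e; rewrite in_setI => /andP[].
  rewrite in_set => /andP[/setIP[_ eb] /fintype.subsetP eC].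
  rewrite in_set => /andP[_ /fintype.subsetP eD].
  move: eb; rewrite inE => /existsP[x /existsP[y /andP[/eqP exy _]]].
  have xe : x \in e by rewrite exy set21.
  by move: (eD x xe); rewrite in_setD (eC x xe).
rewrite cZ; set a := chgs _; set b := chgs _; set c := chgs _; nia.
Qed.

(** A member of the family picks, in each of [N] blocks, any of the two [chi]-classes, whence
    [4 ^ N]. On a flat block a cut is constant on each class, so the flat blocks split into a part
    inside [A] and a part outside; the larger one serves as [U]. *)
Lemma cut_family G b : let N := #|bigv (8 * b) G| %/ b in 0 < N ->
  exists F : {set {set V}}, #|F| <= 4 ^ N /\
    forall A, 8 * #|G :&: bad A| <= N ->
      exists2 U, U \in F & N * b <= 4 * #|U| /\ (U \subset A \/ [disjoint U & A]).
Proof.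
set Z := bigv (8 * b) G => N N0.
have b0 : 0 < b by move: N0; rewrite /N; case: (b).
have Zc : {in Z, forall x, reach G [set x] \subset Z}.
  by move=> x; rewrite inE => xZ; apply/fintype.subsetP => y yx; rewrite inE (reach1_eq yx).
have [v [chi [uv vZ Hv]]] := order_big Zc (subxx Z).
have sv : size v = #|Z| by rewrite -(card_uniqP uv); apply: eq_card.
have Nb : N * b <= size v by rewrite sv; apply: leq_divM.
have svN : size v < N.+1 * b by rewrite sv -ltn_divLR.
pose blk x := index x v %/ b.
pose UP (P : {set 'I_N * bool}) :=
  [set x | [exists i : 'I_N, (i == blk x :> nat) && ((i, chi x) \in P)]].
exists (UP @: setT); split.
  apply: leq_trans (leq_imset_card _ _) _; rewrite cardsT.
  by rewrite -(cardsT {set _}) -powersetT card_powerset cardsT card_prod card_ord card_bool mulnC expnM.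
move=> A HA; set l := map (rho A chi) v.
have sl : size l = size v by rewrite size_map.
have nl x : x \in v -> nth false l (index x v) = rho A chi x.
  by move=> xv; rewrite (nth_map x) ?index_mem // nth_index.
(* By [Hv], with at most [N / 8] violated edges and [#|Z| < N.+1 * b], even [8 * chgs l <= 3 * N]
   holds. *)
have chl : 2 * chgs l <= N.
  have := Hv A; rewrite -/l => H.
  have : viol G A Z <= #|G :&: bad A|.
    by apply/subset_leq_card/fintype.subsetP => e; rewrite in_set => /andP[].
  move: H HA svN; rewrite sv; set d := #|_ :&: _|; set c := chgs l; set w := viol _ _ _ => H Hd svN wd.
  nia.
pose J := [set i : 'I_N | flat b l i].
have cJ : N <= 2 * #|J|.
  have : #|~: J| <= chgs l.
    apply: leq_trans (count_not_flat (N := N) (b := b) _); last by rewrite sl.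
    rewrite -size_filter cardE -(size_map val); apply: uniq_leq_size.
      by rewrite (map_inj_uniq val_inj) enum_uniq.
    move=> _ /mapP[i /[!mem_enum] /[!inE] nf ->].
    by rewrite mem_filter nf mem_iota /= ltn_ord.
  by have := cardsC J; rewrite card_ord; lia.
(* The classes of flat blocks on which membership in [A] equals [c]. *)
pose P c : {set 'I_N * bool} := [set it | (it.1 \in J) && (nth false l (it.1 * b) (+) it.2 == c)].
have inP c x : x \in UP (P c) -> (x \in A) = c.
  rewrite inE => /existsP[i /andP[/eqP ix]]; rewrite inE /= => /andP[iJ /eqP <-].
  have ixN : index x v < N * b by rewrite -ltn_divLR // -/(blk x) -ix.
  have xv : x \in v by rewrite -index_mem; apply: leq_trans Nb.
  move: iJ; rewrite inE => /allP/(_ (index x v)); rewrite mem_iota ix.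
  rewrite leq_divM addnC -mulSn -ltn_divLR // ltnSn => /(_ isT)/eqP <-.
  by rewrite nl // /rho addbK.
have [x0 x0Z] : exists x0, x0 \in Z.
  by apply/card_gt0P; move: N0; rewrite /N; case: #|Z| => //; rewrite div0n.
pose f (it : 'I_N * 'I_b) := nth x0 v (it.1 * b + it.2).
have itlt (it : 'I_N * 'I_b) : it.1 * b + it.2 < size v.
  by apply: leq_trans Nb; case: it => i t /=; have := ltn_ord i; have := ltn_ord t; nia.
have finj : injective f.
  move=> it it' /eqP; rewrite nth_uniq // => /eqP E.
  have E1 : it.1 = it'.1.
    apply: val_inj => /=; have := congr1 (divn^~ b) E.
    by rewrite !divnMDl // !divn_small // !addn0.
  by move: it it' E1 E => [i t] [i' t'] /= -> /addnI/val_inj ->.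
have cU : #|J| * b <= #|UP (P true)| + #|UP (P false)|.
  have -> : #|J| * b = #|[set f it | it in setX J [set: 'I_b]]|.
    by rewrite card_imset // cardsX cardsT card_ord.
  apply: leq_trans (leq_card_setU _ _); apply/subset_leq_card/fintype.subsetP.
  move=> _ /imsetP[[i t] /setXP[/= iJ _] ->]; set x := f (i, t).
  have ib : i == blk x :> nat.
    by rewrite /blk /x /f index_uniq // divnMDl // divn_small // addn0.
  have inU c : nth false l (i * b) (+) chi x == c -> x \in UP (P c).
    by move=> H; rewrite inE; apply/existsP; exists i; rewrite ib inE /= iJ.
  by rewrite in_setU; move: (inU true) (inU false); case: (_ (+) _) => [/(_ isT) ->|_ /(_ isT) ->]; rewrite ?orbT.
have NJ : N * b <= 2 * (#|J| * b) by rewrite mulnA leq_mul2r cJ orbT.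
have [le|/ltnW le] := leqP #|UP (P false)| #|UP (P true)|.
  exists (UP (P true)); first by apply: imset_f; rewrite inE.
  split; first by lia.
  by left; apply/fintype.subsetP => x /inP.
exists (UP (P false)); first by apply: imset_f; rewrite inE.
split; first by lia.
by right; rewrite disjoints_subset; apply/fintype.subsetP => x /inP; rewrite inE => ->.
Qed.
End Ordering.

(** * Expectations in G(n, c/n) *)

Section Inequalities.
Variable R : realFieldType.
Implicit Types (x y p eta : R).

(** Plays the part of an exponential bound: [(1 - y) ^+ n] is at most the inverse of
    [1 + n%:R * y]. *)
Lemma bernoulli_inv y n : 0 <= y <= 1 -> (1 - y) ^+ n * (1 + n%:R * y) <= 1.
Proof.
move=> /andP[y0 y1]; elim: n => [|n IH]; first by rewrite expr0 mul0r addr0 mulr1.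
have h : 0 <= (1 - y) ^+ n by rewrite exprn_ge0 ?subr_ge0.
have n0 : 0 <= n%:R :> R by [].
apply: le_trans IH; rewrite exprSr -mulrA ler_wpM2l // -natr1; nra.
Qed.

(** Bonferroni truncation after the cubic term, with [(n%:R * y) ^+ 3 / 6] in place of the smaller
    binomial term. *)
Lemma bonferroni3 y n : 0 <= y <= 1 ->
  1 - n%:R * y + n%:R * (n%:R - 1) / 2 * y ^+ 2 - (n%:R * y) ^+ 3 / 6 <= (1 - y) ^+ n.
Proof.
move=> /andP[y0 y1]; elim: n => [|n IH]; first by rewrite expr0; lra.
rewrite [leRHS]exprS; have y1' : 0 <= 1 - y by rewrite subr_ge0.
apply: (le_trans _ (ler_wpM2l y1' IH)).
rewrite -natr1; set m := n%:R : R; have m0 : 0 <= m by rewrite /m.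
have : 0 <= y ^+ 3 * (1 + 6 * m + m ^+ 3 * y) by rewrite mulr_ge0 ?exprn_ge0 // !addr_ge0 ?mulr_ge0 ?exprn_ge0.
lra.
Qed.

(** For small [eta] the branching process survives with probability near [2 * eta]. The value
    [4 * eta] lies safely above, which leaves the drift [eta ^+ 2] demanded by [reach_upper]. *)
Lemma survival_subsolution eta n : 0 < eta -> eta <= 10^-1 -> (10 <= n)%N ->
  (1 - 4 * eta) + eta ^+ 2 <= (1 - (1 + eta) / n%:R * (4 * eta)) ^+ n.
Proof.
move=> e0 e1 n10.
have n10' : 10 <= n%:R :> R by rewrite ler_nat.
have nu : n%:R != 0 :> R by apply: lt0r_neq0; lra.
set z := (1 + eta) * (4 * eta).
have z0 : 0 <= z by rewrite /z; nra.
have z1 : z <= 1 by rewrite /z; nra.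
have -> : (1 + eta) / n%:R * (4 * eta) = z / n%:R by rewrite /z; field.
apply: le_trans (bonferroni3 _ _); last first.
  by rewrite divr_ge0 //= ler_pdivrMr; lra.
have -> : n%:R * (z / n%:R) = z by field.
have -> : n%:R * (n%:R - 1) / 2 * (z / n%:R) ^+ 2 = z ^+ 2 / 2 - z ^+ 2 / (2 * n%:R).
  by field.
have H : z ^+ 2 / (2 * n%:R) <= z ^+ 2 / 20.
  by rewrite ler_wpM2l ?sqr_ge0 // lef_pV2 ?posrE; lra.
suff : 1 - 4 * eta + eta ^+ 2 <= 1 - z + z ^+ 2 / 2 - z ^+ 2 / 20 - z ^+ 3 / 6 by lra.
have -> : z ^+ 3 = 64 * eta ^+ 3 * (1 + eta) ^+ 3 by rewrite /z; ring.
have -> : z ^+ 2 = 16 * eta ^+ 2 * (1 + eta) ^+ 2 by rewrite /z; ring.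
have c3 : (1 + eta) ^+ 3 <= 1331 / 1000.
  have -> : 1331 / 1000 = (1 + 10^-1) ^+ 3 :> R by field.
  by rewrite ler_pXn2r ?nnegrE //; lra.
have c2 : 1 <= (1 + eta) ^+ 2 by nra.
have q2 : 0 <= eta ^+ 2 by nra.
have k3 : eta ^+ 3 * (1 + eta) ^+ 3 <= eta ^+ 2 * (1331 / 10000).
  have -> : eta ^+ 3 * (1 + eta) ^+ 3 = eta ^+ 2 * (eta * (1 + eta) ^+ 3) by ring.
  rewrite ler_wpM2l //; apply: le_trans (ler_wpM2l (ltW e0) c3) _; lra.
have k2 : eta ^+ 2 <= eta ^+ 2 * (1 + eta) ^+ 2 by rewrite ler_peMr.
by rewrite /z; clear -k2 k3 q2; lra.
Qed.

End Inequalities.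

(** * Chebyshev's inequality and an upper bound on large clusters *)

Section Concentration.
Variable R : realType.

Lemma Ex_bool_le1 (T : finType) (p : T -> R) (P : {set T} -> bool) :
  isprob p -> Ex p (fun G => (P G)%:R) <= 1.
Proof.
by move=> pp; rewrite -[leRHS](Ex_cst p); apply: le_Ex => // G; rewrite lern1 leq_b1.
Qed.

Lemma chebyshev (T : finType) (p : T -> R) (f : {set T} -> R) (V t : R) :
  isprob p -> 0 < t -> Ex p (fun G => f G ^+ 2) - Ex p f ^+ 2 <= V ->
  Ex p (fun G => (t <= `|f G - Ex p f|)%R%:R) <= V / t ^+ 2.
Proof.
move=> pp t0 HV; set m := Ex p f in HV *.
rewrite ler_pdivlMr ?exprn_gt0 // mulrC -ExZ; apply: le_trans HV.
have -> : Ex p (fun G => f G ^+ 2) - m ^+ 2 = Ex p (fun G => (f G - m) ^+ 2).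
  rewrite (eq_Ex _ (f := fun G => (f G - m) ^+ 2)
                   (g := fun G => f G ^+ 2 + (- 2 * m * f G + m ^+ 2))); last first.
    by move=> G; ring.
  by rewrite !ExD ExZ Ex_cst -/m; ring.
apply: le_Ex => // G; case: (leP t) => [tf|_]; last by rewrite mulr0 sqr_ge0.
by rewrite mulr1 -[leRHS]real_normK ?num_real // ler_pXn2r // nnegrE // ltW.
Qed.

Lemma card_pairs (V : finType) : #|pairs V| = 'C(#|V|, 2).
Proof. exact: card_draws. Qed.

Lemma sum_pairs_le n (c : R) : 0 <= c -> c <= 2 ->
  \sum_(e in pairs 'I_n) unif (pairs 'I_n) (c / n%:R) e <= 2 * n%:R.
Proof.
move=> c0 c2; rewrite (eq_bigr (fun=> c / n%:R)) => [|e eP]; last by rewrite /unif eP.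
rewrite sumr_const card_pairs card_ord.
case: n => [|n]; first by rewrite mulr0.
have le_sq : ('C(n.+1, 2) <= n.+1 * n.+1)%N.
  by rewrite bin2 /= -divn2; apply: leq_trans (leq_div _ _) _; rewrite leq_mul2l leqnSn orbT.
rewrite -[leLHS]mulr_natl; apply: le_trans (_ : (n.+1 * n.+1)%:R * (c / n.+1%:R) <= _).
  by rewrite ler_wpM2r ?ler_nat // divr_ge0.
rewrite natrM -mulrA [_ * (c / _)]mulrC divfK ?pnatr_eq0 // mulrC.
by rewrite ler_wpM2r.
Qed.

Lemma prob_cn n (c : R) : 0 <= c -> c <= 2 -> (2 <= n)%N -> 0 <= c / n%:R <= 1.
Proof.
move=> c0 c2 n2; have n2' : 2 <= n%:R :> R by rewrite ler_nat.
by rewrite divr_ge0 //= ler_pdivrMr; lra.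
Qed.

(** [K] depends on [eta] but not on [n]. With [be ^+ H <= 1/2] and [de = 1/K], [reach_upper] started
    from one vertex gives [4 * eta / (1 - be ^+ H) <= 8 * eta]. *)
Lemma big_cluster_upper (eta : R) : 0 < eta -> eta <= 1 -> exists K, forall n (u : 'I_n),
  (10 <= n)%N ->
  Ex (unif (pairs 'I_n) ((1 + eta) / n%:R)) (fun G => (u \in bigv K G)%:R) <= 10 * eta.
Proof.
(* Above 1/10 the claimed bound exceeds 1, so any [K] will do. *)
move=> e0 e1; have [e10|e10] := leP eta (10^-1); last first.
  exists 0%N => n u n10; apply: le_trans (Ex_bool_le1 _ _) _; last by lra.
  by apply/isprob_unif/prob_cn; [lra|lra|apply: leq_trans n10].
pose x := 4 * eta; pose be := 1 - x.
have be0 : 0 < be by rewrite /be /x; lra.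
have be1 : be <= 1 by rewrite /be /x; lra.
have x0 : 0 < x by rewrite /x; lra.
have [H bH] : exists H, be ^+ H <= 2^-1.
  exists (Num.bound x^-1); set H := Num.bound _.
  have xH : 1 <= H%:R * x.
    by rewrite -ler_pdivrMr // div1r ltW // archi_boundP // invr_ge0 ltW.
  have := @bernoulli_inv R x H; rewrite -/be => /(_ _)/wrap[].
    by rewrite /x; apply/andP; lra.
  have : 0 <= be ^+ H by rewrite exprn_ge0 // ltW.
  nra.
have g0 : 0 < eta ^+ 2 * be ^+ H by rewrite mulr_gt0 ?exprn_gt0.
pose K := Num.bound (eta ^+ 2 * be ^+ H)^-1.
have Kp : (eta ^+ 2 * be ^+ H)^-1 < K%:R by rewrite archi_boundP // invr_ge0 ltW.
have K0 : 0 < K%:R :> R by apply: lt_trans Kp; rewrite invr_gt0.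
exists K => n u n10.
have p01 : 0 <= (1 + eta) / n%:R <= 1.
  by apply: prob_cn; [lra|lra|apply: leq_trans n10].
have := @reach_upper 'I_n R ((1 + eta) / n%:R) be (eta ^+ 2) K%:R^-1 H K (pairs 'I_n) [set u] p01.
rewrite cards1 expr1 mulfV ?gt_eqF // addrK (eq_Ex _ (g := fun G => (u \in bigv K G)%:R)); last first.
  by move=> G; rewrite inE.
move=> H1; apply: le_trans (H1 _ _ _ _ _ _) _ => {H1} //.
- by rewrite be0.
- by apply: le_lt_trans bH _; lra.
- exact: sqr_ge0.
- rewrite card_ord.
  have -> : 1 - (1 + eta) / n%:R + (1 + eta) / n%:R * be = 1 - (1 + eta) / n%:R * (4 * eta).
    by rewrite /be /x; ring.
  exact: survival_subsolution.
- by rewrite invr_ge0 ltW //= -[leRHS]invrK lef_pV2 ?posrE ?invr_gt0 // ltW.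
have F : 2^-1 <= 1 - be ^+ H by lra.
rewrite ler_pdivrMr; last by lra.
by rewrite /be /x; nra.
Qed.

End Concentration.

(** * Connected pairs and the upper bound on the mean distance *)

Section Expectations.
Variable R : realType.

(** Apply [reach_lower] with [x = eta / 4]: at least [n - 2 * s] vertices remain to be revealed, and
    [bernoulli_inv] then gives the required drift. *)
Lemma big_cluster_lower (eta : R) s n (u : 'I_n) : 0 < eta -> eta <= 1 -> (2 <= n)%N ->
  8 * s%:R <= n%:R * eta ->
  1 - eta / 4 >= Ex (unif (pairs 'I_n) ((1 + eta) / n%:R)) (fun G => (u \notin bigv s G)%:R).
Proof.
move=> e0 e1 n2 sn.
have p01 : 0 <= (1 + eta) / n%:R <= 1 by apply: prob_cn => //; lra.
have n0 : 0 < n%:R :> R by rewrite ltr0n; apply: leq_trans n2.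
have s2n : (2 * s <= n)%N.
  rewrite -(ler_nat R) natrM; have : n%:R * eta <= n%:R by rewrite ler_piMr // ltW.
  by have := ler0n R s; lra.
have x01 : 0 <= eta / 4 <= 1 by apply/andP; lra.
have := @reach_lower 'I_n R ((1 + eta) / n%:R) (eta / 4) (n - 2 * s) s setT (pairs 'I_n) [set u] p01 x01.
rewrite cards1 expr1 cardsT card_ord subnK // => /(_ _ _ _ _)/wrap[].
- set y := (1 + eta) / n%:R * (eta / 4); set m := (n - 2 * s)%N.
  have y01 : 0 <= y <= 1 by have /andP[q0 q1] := p01; rewrite /y; apply/andP; nra.
  have := bernoulli_inv m y01.
  have /andP[y0 y1] := y01.
  have h : 0 <= (1 - y) ^+ m by rewrite exprn_ge0 // subr_ge0.
  suff : 1 <= (1 - eta / 4) * (1 + m%:R * y) by move=> H1 H2; nra.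
  have -> : m%:R * y = (1 + eta) * (1 - 2 * s%:R / n%:R) * (eta / 4).
    by rewrite /m /y natrB // natrM; field; rewrite gt_eqF.
  have : 2 * s%:R / n%:R <= eta / 4 by rewrite ler_pdivrMr //; lra.
  set t := 2 * s%:R / n%:R => t4.
  have H : 1 <= (1 + eta) * (1 - eta / 4) * (1 - t).
    have : 1 <= (1 + eta) * (1 - eta / 4) * (1 - eta / 4) by nra.
    move=> /le_trans; apply; rewrite ler_wpM2l //; last by lra.
    by rewrite mulr_ge0; lra.
  nra.
- by move=> a b _ _; apply: pairsP.
- exact: subsetT.
- by [].
apply: le_trans; apply: le_Ex => [|G]; first exact: isprob_unif.
by rewrite finset.setIT inE ltnNge.
Qed.

(* Clusters of size at least [K] lie inside the set of vertices of large clusters, so they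
   contribute at most its squared size. *)
Lemma sum_connected_le (V : finType) K (G : {set {set V}}) :
  (\sum_(a : V) \sum_(b : V) (b \in reach G [set a]) <= #|V| * K + #|bigv K G| * #|bigv K G|)%N.
Proof.
have -> : (\sum_(a : V) \sum_(b : V) (b \in reach G [set a]) = \sum_(a : V) #|reach G [set a]|)%N.
  by apply: eq_bigr => a _; rewrite -sum1_card [RHS]big_mkcond /=; apply: eq_bigr => b _; case: (b \in _).
rewrite (bigID (mem (bigv K G))) /= addnC; apply: leq_add.
  rewrite -sum_nat_const; apply: leq_trans (_ : (\sum_(a | a \notin bigv K G) K <= _)%N).
    by apply: leq_sum => a; rewrite inE -ltnNge => /ltnW.
  by rewrite [leqRHS](bigID (fun a => a \notin bigv K G)) /= leq_addr.
rewrite -sum_nat_const; apply: leq_sum => a aK; apply: subset_leq_card.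
apply/fintype.subsetP => b ba; rewrite inE (reach1_eq ba); by rewrite inE in aK.
Qed.

Lemma bigv_lipR (V : finType) K (G : {set {set V}}) e : e \in pairs V ->
  `|(#|bigv K (e |: G)|%:R - #|bigv K G|%:R)%R| <= (2 * K)%:R :> R.
Proof.
move=> /pairsE[a [b [_ ->]]]; have le1 := subset_leq_card (bigv_mono K G [set a; b]).
by rewrite -natrB // normr_nat ler_nat leq_subLR bigv_lip.
Qed.

Lemma bigv_variance n K (c : R) : 0 <= c -> c <= 2 -> (2 <= n)%N ->
  Ex (unif (pairs 'I_n) (c / n%:R)) (fun G => #|bigv K G|%:R ^+ 2) -
  Ex (unif (pairs 'I_n) (c / n%:R)) (fun G => #|bigv K G|%:R) ^+ 2 <= 8 * K%:R ^+ 2 * n%:R.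
Proof.
move=> c0 c2 n2; set p := unif _ _.
have pp : isprob p by apply/isprob_unif/prob_cn.
have psupp e : e \notin pairs 'I_n -> p e = 0 by move=> /negbTE eP; rewrite /p /unif eP.
apply: le_trans (efron_stein (L := (2 * K)%:R) pp psupp _) _.
  by move=> e G eP; apply: bigv_lipR.
apply: le_trans (ler_wpM2l (sqr_ge0 _) (sum_pairs_le n c0 c2)) _.
by rewrite natrM le_eqVlt; apply/orP; left; apply/eqP; ring.
Qed.

Definition mean_conn n (p : R) : R := Ex (unif (pairs 'I_n) p)
  (fun G => (\sum_(a : 'I_n) \sum_(b : 'I_n) (b \in reach G [set a]))%N%:R).

Lemma Ex_bigv n K p : Ex p (fun G : {set {set 'I_n}} => #|bigv K G|%:R : R) =
  \sum_(u : 'I_n) Ex p (fun G => (u \in bigv K G)%:R).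
Proof.
rewrite -Ex_sum; apply: eq_Ex => G; rewrite -sum1_card natr_sum big_mkcond /=.
by apply: eq_bigr => u _; case: (u \in _).
Qed.

(** The variance of the number [Y] of vertices in large clusters is linear in [n], so only the
    squared mean is quadratic; [M] gathers the linear terms. *)
Lemma mean_conn_upper (eta : R) : 0 < eta -> eta <= 1 -> exists2 M : R, 0 <= M &
  forall n, (10 <= n)%N -> mean_conn n ((1 + eta) / n%:R) <= 100 * eta ^+ 2 * n%:R ^+ 2 + M * n%:R.
Proof.
move=> e0 e1; have [K HK] := big_cluster_upper e0 e1.
exists (K%:R + 8 * K%:R ^+ 2) => [|n n10]; first by rewrite addr_ge0 // mulr_ge0 ?sqr_ge0.
have n2 : (2 <= n)%N by apply: leq_trans n10.
set p := unif (pairs 'I_n) ((1 + eta) / n%:R).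
have pp : isprob p by apply/isprob_unif/prob_cn => //; lra.
pose Y (G : {set {set 'I_n}}) := #|bigv K G|%:R : R.
have H1 : mean_conn n ((1 + eta) / n%:R) <= n%:R * K%:R + Ex p (fun G => Y G ^+ 2).
  rewrite -(Ex_cst p (n%:R * K%:R)) -ExD; apply: le_Ex => // G.
  by have := sum_connected_le K G; rewrite -(ler_nat R) natrD !natrM card_ord expr2.
have H2 : Ex p (fun G => Y G ^+ 2) - Ex p Y ^+ 2 <= 8 * K%:R ^+ 2 * n%:R.
  by apply: bigv_variance => //; lra.
have H3 : Ex p Y <= 10 * eta * n%:R.
  rewrite Ex_bigv; apply: le_trans (_ : \sum_(u : 'I_n) 10 * eta <= _).
    by apply: ler_sum => u _; apply: HK.
  by rewrite sumr_const card_ord -[leLHS]mulr_natr.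
have H4 : 0 <= Ex p Y by apply: Ex_ge0.
have H5 : Ex p Y ^+ 2 <= (10 * eta * n%:R) ^+ 2.
  by rewrite ler_pXn2r // nnegrE; apply: le_trans H3.
move: H1 H2 H5; lra.
Qed.

Definition mean_dist n (p : R) : R := Ex (unif (pairs 'I_n) p) (fun G => (dist_bp G)%:R).

(** The function [h] tests whether the ends of [e] are already connected: by [dist_bp_pivot] only
    then can [e] raise the distance. Since [h] is increasing, [Ex_lindeberg] applies. *)
Lemma mean_dist_lindeberg n (p q : R) : 0 <= p -> p <= q -> q <= 1 ->
  mean_dist n q - mean_dist n p <= (q - p) * mean_conn n q.
Proof.
move=> p0 pq q1; have q0 := le_trans p0 pq; have p1 := le_trans pq q1.
set P := pairs 'I_n.
have pp : isprob (unif P p) by apply: isprob_unif; rewrite p0.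
have qq : isprob (unif P q) by apply: isprob_unif; rewrite q0.
pose h (e : {set 'I_n}) (G : {set {set 'I_n}}) : R :=
  [exists a, exists b, (e == [set a; b]) && (b \in reach G [set a])]%:R.
apply: le_trans (Ex_lindeberg (Q := P) (h := h) pp qq _ _ _ _) _.
- by move=> e; rewrite /unif; case: ifP.
- by move=> e /negbTE eP; rewrite /unif eP.
- move=> e G /pairsE[a [b [ab ->]]].
  have [bC|bC] := boolP (b \in reach G [set a]); last by rewrite dist_bp_pivot // subrr.
  have -> : h [set a; b] G = 1.
    rewrite /h (_ : [exists a, _] = true) //; apply/existsP; exists a; apply/existsP; exists b.
    by rewrite eqxx.
  by rewrite lerBlDl natr1 ler_nat dist_bpU1.
- move=> e e' G; rewrite /h ler_nat.
  case: (boolP [exists a, _]) => // /existsP[a /existsP[b /andP[/eqP -> bC]]].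
  rewrite (_ : [exists a0, _] = true) //; apply/existsP; exists a; apply/existsP; exists b.
  by rewrite eqxx (fintype.subsetP (reach_mono _ (subsetUr _ G)) _ bC).
rewrite (eq_bigr (fun e => (q - p) * Ex (unif P q) (h e))) => [|e eP]; last first.
  by rewrite /unif eP.
rewrite -mulr_sumr ler_wpM2l ?subr_ge0 // -Ex_sum; apply: le_Ex => // G.
(* Passing to ordered pairs: after exchanging the sums, each [(a, b)] meets at most one [e]. *)
apply: le_trans (_ : \sum_(e in P) \sum_a \sum_b
   ((e == [set a; b]) && (b \in reach G [set a]))%:R <= _).
  apply: ler_sum => e _; rewrite /h; case: existsP => [[a /existsP[b H]]|_].
    rewrite (bigD1 a) //= (bigD1 b) //= H -addrA lerDl.
    by rewrite addr_ge0 // sumr_ge0 // => i _; rewrite sumr_ge0.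
  by rewrite sumr_ge0 // => i _; rewrite sumr_ge0.
rewrite natr_sum exchange_big; apply: ler_sum => a _.
rewrite natr_sum exchange_big; apply: ler_sum => b _ /=.
case: (b \in _); last by rewrite big1 // => e _; rewrite andbF.
rewrite (eq_bigr (fun e => (e == [set a; b])%:R)) => [|e _]; last by rewrite andbT.
rewrite -natr_sum ler_nat.
have -> : (\sum_(e in P) (e == [set a; b]) = \sum_(e in P | e == [set a; b]) 1)%N.
  by rewrite [RHS]big_mkcondr; apply: eq_bigr => e _; case: (e == _).
apply: (@leq_trans #|[set [set a; b]]|); last by rewrite cards1.
rewrite sum1_card; apply: subset_leq_card; apply/fintype.subsetP => e.
by rewrite in_set1 => /andP[].
Qed.

(** Going from 0 to [(1 + eps ^+ 2) / n] costs at most [200 * eps ^+ 4 * n], and from there to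
    [(1 + eps) / n] at most [100 * eps ^+ 3 * n], up to additive constants that the last unit of 301
    absorbs for large [n]. A single increment from 0 would give only order [eps ^+ 2 * n]. *)
Lemma mean_dist_upper (eps : R) : 0 < eps -> eps < 1 -> exists n0, forall n, (n0 <= n)%N ->
  mean_dist n ((1 + eps) / n%:R) <= 301 * eps ^+ 3 * n%:R.
Proof.
move=> e0 e1; have e20 : 0 < eps ^+ 2 by rewrite exprn_gt0.
have e21 : eps ^+ 2 <= eps by rewrite expr2; nra.
have [M1 M10 H1] := mean_conn_upper e20 (le_trans e21 (ltW e1)).
have [M2 M20 H2] := mean_conn_upper e0 (ltW e1).
have e30 : 0 < eps ^+ 3 by rewrite exprn_gt0.
pose n1 := Num.bound ((2 * M1 + M2) / eps ^+ 3).
exists (maxn 10 n1) => n; rewrite geq_max => /andP[n10 nn1].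
have n0 : 0 < n%:R :> R by rewrite ltr0n; apply: leq_trans n10.
have n2 : (2 <= n)%N by apply: leq_trans n10.
have HM : 2 * M1 + M2 <= eps ^+ 3 * n%:R.
  have HB : (2 * M1 + M2) / eps ^+ 3 < n1%:R.
    by apply: archi_boundP; apply: divr_ge0; [rewrite addr_ge0 // mulr_ge0|exact: ltW].
  by rewrite [leRHS]mulrC -ler_pdivrMr // (le_trans (ltW HB)) // ler_nat.
set q := (1 + eps ^+ 2) / n%:R; set p := (1 + eps) / n%:R.
have /andP[q0 q1] : 0 <= q <= 1 by apply: prob_cn => //; lra.
have /andP[p0 p1] : 0 <= p <= 1 by apply: prob_cn => //; lra.
have qp : q <= p by rewrite ler_wpM2r ?invr_ge0 ?(ltW n0) // lerD2l.
have L1 := mean_dist_lindeberg n (lexx 0) q0 q1.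
have L2 := mean_dist_lindeberg n q0 qp p1.
have E0 : mean_dist n 0 = 0.
  by rewrite /mean_dist Ex_supp0 ?dist_bp0 // => e; rewrite /unif; case: ifP.
rewrite E0 !subr0 in L1.
have {}L1 : mean_dist n q <= 200 * eps ^+ 3 * n%:R + 2 * M1.
  apply: le_trans L1 _; apply: le_trans (ler_wpM2l q0 (H1 n n10)) _.
  have -> : q * (100 * (eps ^+ 2) ^+ 2 * n%:R ^+ 2 + M1 * n%:R) =
    (1 + eps ^+ 2) * (100 * eps ^+ 4 * n%:R + M1) by rewrite /q; field; rewrite gt_eqF.
  have : 0 <= 100 * eps ^+ 4 * n%:R + M1 by rewrite addr_ge0 // !mulr_ge0 ?exprn_ge0 // ltW.
  have : eps ^+ 4 * n%:R <= eps ^+ 3 * n%:R.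
    by rewrite ler_wpM2r ?(ltW n0) // exprSr ler_piMr // ltW.
  nra.
have {}L2 : mean_dist n p - mean_dist n q <= 100 * eps ^+ 3 * n%:R + M2.
  have pq0 : 0 <= p - q by rewrite subr_ge0.
  apply: le_trans L2 _; apply: le_trans (ler_wpM2l pq0 (H2 n n10)) _.
  have -> : (p - q) * (100 * eps ^+ 2 * n%:R ^+ 2 + M2 * n%:R) =
    (eps - eps ^+ 2) * (100 * eps ^+ 2 * n%:R + M2) by rewrite /p /q; field; rewrite gt_eqF.
  have h : 0 <= 100 * eps ^+ 2 * n%:R + M2 by rewrite addr_ge0 // !mulr_ge0 ?exprn_ge0 // ltW.
  apply: le_trans (_ : eps * (100 * eps ^+ 2 * n%:R + M2) <= _).
    by rewrite ler_wpM2r //; lra.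
  have : eps * M2 <= M2 by rewrite ler_piMl // ltW.
  by rewrite mulrDr (_ : eps * (100 * eps ^+ 2 * n%:R) = 100 * eps ^+ 3 * n%:R); [lra|ring].
lra.
Qed.

End Expectations.

(** * Sprinkling and the lower bound on the mean distance *)

Section Lower.
Variable R : realType.

Definition inner (V : finType) (U : {set V}) : {set {set V}} :=
  [set e : {set V} | (e \subset U) && (#|e| == 2%N)].

Lemma inner_pairs (V : finType) (U : {set V}) : inner U \subset pairs V.
Proof. by apply/fintype.subsetP => e; rewrite !inE => /andP[]. Qed.

Lemma inner_bad (V : finType) (U A : {set V}) : (U \subset A) \/ [disjoint U & A] ->
  inner U \subset bad A.
Proof.
move=> UA; apply/fintype.subsetP => e; rewrite inE => /andP[eU e2].
have /pairsE[a [b [_ eab]]] : e \in pairs V by rewrite inE.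
move: eU; rewrite eab bad_edge subUset !sub1set => /andP[aU bU].
by case: UA => [/fintype.subsetP UA|UA]; [rewrite !UA|rewrite !(disjointFr UA)].
Qed.

(** Union bound with exponential moments. A set [U] from [cut_family] has at least [t] vertices,
    hence at least [N * (d * d * N)] inner pairs, and the last hypothesis makes [q ^+ (d * d * N)]
    at most 1/32. In total [4 ^ N * 2 ^ N / 32 ^ N = 4 ^ (- N)]. *)
Lemma sprinkled_cut (V : finType) (G1 : {set {set V}}) d (p : R) :
  let N := (#|bigv (64 * d) G1| %/ (8 * d))%N in
  (0 < N)%N -> 0 <= p <= 1 -> 31 <= (d * d * N)%:R * (p / 2) ->
  Ex (unif (pairs V) p) (fun G2 => (8 * dist_bp (G1 :|: G2) <= N)%N%:R) <= 4^-1.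
Proof.
move=> N N0 p01 Hm; have /andP[p0 p1] := p01.
have pp : isprob (unif (pairs V) p) by apply: isprob_unif.
have [] := @cut_family V G1 (8 * d)%N; rewrite (mulnA 8 8 d) // -/N => F [cF HF].
set q := 1 - p / 2.
have q0 : 0 <= q by rewrite /q; lra.
have q1 : q <= 1 by rewrite /q; lra.
have qm : q ^+ (d * d * N) <= 32^-1.
  have y01 : 0 <= p / 2 <= 1 by apply/andP; lra.
  have := bernoulli_inv (d * d * N) y01; rewrite -/q.
  have qN0 : 0 <= q ^+ (d * d * N) by rewrite exprn_ge0.
  move=> le1; rewrite -div1r ler_pdivlMr //; apply: le_trans le1.
  by rewrite ler_wpM2l // (_ : 32 = 1 + 31) ?lerD2l //; ring.
pose t := (2 * d * N)%N.
have tC : (N * (d * d * N) <= 'C(t, 2))%N.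
  rewrite bin2 -divn2 leq_divRL // /t; case: (posnP d) => [->|d0]; first by rewrite !(mul0n, muln0).
  by rewrite -subn1; nia.
have bound1 (U : {set V}) : (t <= #|U|)%N ->
    Ex (unif (pairs V) p) (fun G2 => 2^-1 ^+ #|G2 :&: inner U|) <= 32^-1 ^+ N.
  move=> tU; rewrite Ex_half_pow ?inner_pairs // -/q.
  apply: le_trans (_ : q ^+ (d * d * N * N) <= _); last first.
    by rewrite exprM; apply: lerXn2r; rewrite ?nnegrE ?exprn_ge0 ?invr_ge0.
  apply: ler_wiXn2l => //; rewrite mulnC; apply: leq_trans tC _.
  by rewrite cards_draws leq_bin2l.
apply: le_trans (_ : Ex (unif (pairs V) p) (fun G2 => \sum_(U in F | (t <= #|U|)%N)
    2 ^+ N * 2^-1 ^+ #|G2 :&: inner U|) <= _).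
  apply: le_Ex => // G2; have [A dA] := dist_bp_ex (G1 :|: G2).
  case: (leqP (8 * _) N) => [le|_]; last first.
    by apply: sumr_ge0 => U _; rewrite mulr_ge0 ?exprn_ge0 ?invr_ge0.
  have [|U UF [NU UA]] := HF A.
    apply: leq_trans le; rewrite leq_mul2l /= dA; apply: subset_leq_card.
    by apply: setSI; apply: subsetUl.
  have tU : (t <= #|U|)%N by rewrite /t; clear -NU; lia.
  (* The event even gives [N / 8]; the cruder [N] already makes the summand of [U] at least 1. *)
  have GU : (#|G2 :&: inner U| <= N)%N.
    apply: leq_trans (leq_trans (leq_pmull _ (n := 8) _) le) => //.
    rewrite dA; apply: subset_leq_card; apply: setISS (inner_bad UA); exact: subsetUr.
  rewrite (bigD1 U) ?UF //= -[leLHS]addr0 lerD //; last first.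
    by apply: sumr_ge0 => U' _; rewrite mulr_ge0 ?exprn_ge0 ?invr_ge0.
  rewrite exprVn ler_pdivlMr ?exprn_gt0 // mul1r; apply: ler_weXn2l GU; rewrite ler1n //.
rewrite (Ex_sum _ _ _ (fun (U : {set V}) G2 => 2 ^+ N * 2^-1 ^+ #|G2 :&: inner U|)).
apply: le_trans (_ : \sum_(U in F) (2 ^+ N * 32^-1 ^+ N) <= _).
  rewrite [leRHS](bigID (fun U : {set V} => (t <= #|U|)%N)) /= -[leLHS]addr0; apply: lerD.
    by apply: ler_sum => U /andP[_ tU]; rewrite ExZ ler_wpM2l ?exprn_ge0 // bound1.
  by apply: sumr_ge0 => U _; rewrite mulr_ge0 ?exprn_ge0 ?invr_ge0.
rewrite sumr_const -[leLHS]mulr_natl; apply: le_trans (_ : 4 ^+ N * (2 ^+ N * 32^-1 ^+ N) <= _).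
  by rewrite ler_wpM2r ?mulr_ge0 ?exprn_ge0 ?invr_ge0 // -natrX ler_nat.
rewrite -!exprMn (_ : 4 * (2 / 32) = 4^-1); last by field.
by rewrite -[leRHS]expr1; apply: ler_wiXn2l; rewrite ?invr_ge0 ?invf_le1 ?ler1n.
Qed.

Lemma mean_dist_lower (eps : R) : 0 < eps -> eps < 1 -> exists n0, forall n, (n0 <= n)%N ->
  eps ^+ 3 * n%:R / (64 * (32 * 32) * (16 * 16) * 16) <= mean_dist n ((1 + eps) / n%:R).
Proof.
move=> e0 e1; pose eta := eps / 2.
have eta0 : 0 < eta by rewrite divr_gt0.
have eta1 : eta <= 1 by rewrite /eta; lra.
have [c0 c2] : 0 <= 1 + eta /\ 1 + eta <= 2 by split; lra.
have [c0' c2'] : 0 <= 1 + eps /\ 1 + eps <= 2 by split; lra.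
have eta2 : eta <= 2 by lra.
have e20 : 0 < eps ^+ 2 by rewrite exprn_gt0.
have e21 : eps ^+ 2 <= 1 by rewrite exprn_ile1 ?ltW.
(* The constant makes [d * eps ^+ 2 / 1024] at least 32, where [sprinkled_cut] asks for 31. *)
pose d := (Num.truncn ((32 * (32 * 32)) / eps ^+ 2)).+1.
have big1 : 1 <= (32 * (32 * 32)) / eps ^+ 2 by rewrite ler_pdivlMr // mul1r; lra.
have /andP[d1 d2] : (32 * (32 * 32)) / eps ^+ 2 <= d%:R <= (64 * (32 * 32)) / eps ^+ 2.
  have b0 : 0 <= (32 * (32 * 32)) / eps ^+ 2 by lra.
  have /andP[t1 t2] := truncn_itv b0.
  rewrite (ltW t2) /= /d -natr1 (_ : (64 * (32 * 32)) / eps ^+ 2 = 2 * ((32 * (32 * 32)) / eps ^+ 2)); last by ring.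
  lra.
have dp : 0 < d%:R :> R by lra.
pose s := (64 * d)%N.
have s1 : 1 <= s%:R :> R by rewrite ler1n.
(* This size makes the Chebyshev bound for [Y] at most 1/4. *)
exists (Num.bound ((2 * (64 * 64)) * s%:R ^+ 2 / eps ^+ 2)) => n nn.
have Hn : (2 * (64 * 64)) * s%:R ^+ 2 <= n%:R * eps ^+ 2.
  rewrite -ler_pdivrMr //; apply: le_trans (_ : (Num.bound ((2 * (64 * 64)) * s%:R ^+ 2 / eps ^+ 2))%:R <= _).
    by apply/ltW/archi_boundP; rewrite divr_ge0 ?(ltW e20) // !mulr_ge0 ?sqr_ge0.
  by rewrite ler_nat.
have s2 : s%:R <= s%:R ^+ 2 :> R by rewrite expr2 ler_peMr //; lra.
have nbig : (2 * (64 * 64)) <= n%:R :> R by nra.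
have n0 : 0 < n%:R :> R by lra.
have n2 : (2 <= n)%N by rewrite -(ler_nat R); lra.
have sn : (2 * (64 * 64)) * s%:R <= n%:R * eps by nra.
set P := pairs 'I_n.
set p1 := (1 + eta) / n%:R; set p2 := eta / n%:R.
have p101 : 0 <= p1 <= 1 by apply: prob_cn.
have p201 : 0 <= p2 <= 1 by apply: prob_cn => //; apply: ltW.
have p01 : 0 <= (1 + eps) / n%:R <= 1 by apply: prob_cn.
have /andP[p10 p11] := p101; have /andP[p20 p21] := p201.
have pp1 : isprob (unif P p1) by apply: isprob_unif.
have pp2 : isprob (unif P p2) by apply: isprob_unif.
(* The union of the two rounds has edge probability [p1 + p2 - p1 * p2], at most
   [p1 + p2 = (1 + eps) / n]. *)
have Ecouple : Ex (unif P p1) (fun G1 => Ex (unif P p2) (fun G2 => (dist_bp (G1 :|: G2))%:R))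
    <= mean_dist n ((1 + eps) / n%:R).
  rewrite (Ex_sprinkle (unif P p1) (unif P p2) (fun G => (dist_bp G)%:R)).
  have E0 : 0 <= p1 + p2 - p1 * p2 <= 1 by apply/andP; nra.
  apply: Ex_mono.
  - by move=> e; rewrite /unif; case: ifP => // _; rewrite mulr0 addr0 subr0 lexx ler01.
  - exact: isprob_unif.
  - move=> e; rewrite /unif; case: ifP => _; last by rewrite mulr0 addr0 subr0.
    have -> : (1 + eps) / n%:R = p1 + p2 by rewrite /p1 /p2 /eta; field; rewrite gt_eqF.
    by rewrite lerBlDr lerDl mulr_ge0.
  - by move=> e G; rewrite ler_nat dist_bp_mono ?subsetUr.
pose Y (G : {set {set 'I_n}}) := #|bigv s G|%:R : R.
(* If [Y] reaches [n * eps / 16], half the bound on its mean, the number of blocks is at least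
   [2 * T] before rounding down, hence at least [T] because [1 <= T]. *)
pose T := n%:R * eps / ((16 * 16) * d%:R).
have sE : s%:R = 64 * d%:R :> R by rewrite /s natrM.
have T1 : 1 <= T by rewrite /T ler_pdivlMr ?mulr_gt0 //; lra.
have EY : n%:R * eps / 8 <= Ex (unif P p1) Y.
  rewrite Ex_bigv.
  have Eu u : eps / 8 <= Ex (unif P p1) (fun G => (u \in bigv s G)%:R).
    have sn' : 8 * s%:R <= n%:R * eta by rewrite /eta; clear -sn s1; lra.
    have := big_cluster_lower u eta0 eta1 n2 sn'; rewrite -/P -/p1 /eta.
    have -> : Ex (unif P p1) (fun G => (u \in bigv s G)%:R) =
        1 - Ex (unif P p1) (fun G => (u \notin bigv s G)%:R).
      rewrite -{2}(Ex_cst (unif P p1) 1) -ExB; apply: eq_Ex => G.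
      by case: (u \in _); rewrite ?subr0 ?subrr.
    by clear; lra.
  apply: le_trans (ler_sum _ (fun u _ => Eu u)).
  by rewrite sumr_const card_ord -[leRHS]mulr_natl; lra.
have PY : Ex (unif P p1) (fun G => (n%:R * eps / 16 <= Y G)%R%:R) >= 3 / 4.
  have t0 : 0 < n%:R * eps / 16 by rewrite divr_gt0 // mulr_gt0.
  have V : Ex (unif P p1) (fun G => Y G ^+ 2) - Ex (unif P p1) Y ^+ 2 <= 8 * s%:R ^+ 2 * n%:R.
    exact: bigv_variance.
  have := chebyshev pp1 t0 V.
  have -> : 8 * s%:R ^+ 2 * n%:R / (n%:R * eps / 16) ^+ 2 = (2 * (32 * 32)) * s%:R ^+ 2 / (n%:R * eps ^+ 2).
    by field; rewrite !gt_eqF.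
  have : (2 * (32 * 32)) * s%:R ^+ 2 / (n%:R * eps ^+ 2) <= 4^-1.
    by rewrite ler_pdivrMr ?mulr_gt0 //; clear -Hn; lra.
  set v := (2 * (32 * 32)) * _ / _ => v4 Pv.
  suff : 1 - Ex (unif P p1) (fun G => (n%:R * eps / 16 <= `|Y G - Ex (unif P p1) Y|)%R%:R) <=
      Ex (unif P p1) (fun G => (n%:R * eps / 16 <= Y G)%R%:R) by lra.
  rewrite -{1}(Ex_cst (unif P p1) 1) -ExB; apply: le_Ex => // G.
  case: (leP _ (Y G)) => [_|lt]; first by rewrite lerBlDr lerDl.
  by rewrite (_ : (_ <= `|_|) = true) ?subrr // ler0_norm; clear -lt EY t0; lra.
have main G1 : T * (3 / 4) * (n%:R * eps / 16 <= Y G1)%R%:R <=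
    8 * Ex (unif P p2) (fun G2 => (dist_bp (G1 :|: G2))%:R).
  case: (leP _ (Y G1)) => [YG|_]; last by rewrite mulr0 mulr_ge0 // Ex_ge0.
  rewrite mulr1 -ExZ; set N := (#|bigv s G1| %/ (8 * d))%N.
  have NT : T <= N%:R.
    have : (#|bigv s G1| < N.+1 * (8 * d))%N by rewrite -ltn_divLR // muln_gt0.
    rewrite -(ltr_nat R) natrM natrM -natr1 -/(Y G1) => lt.
    have : 2 * T * (8 * d%:R) = n%:R * eps / 16.
      by rewrite /T; field; rewrite gt_eqF.
    nra.
  have N0 : (0 < N)%N by rewrite -(ltr_nat R); lra.
  have cut := @sprinkled_cut _ G1 d p2 N0 p201.
  have {}cut : Ex (unif P p2) (fun G2 => (8 * dist_bp (G1 :|: G2) <= N)%N%:R) <= 4^-1.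
    apply: cut; rewrite -/s -/N natrM natrM.
    apply: le_trans (_ : d%:R * d%:R * T * (p2 / 2) <= _); last first.
      by rewrite ler_wpM2r ?divr_ge0 ?(ltW e0) // ler_wpM2l // mulr_ge0 // ltW.
    have -> : d%:R * d%:R * T * (p2 / 2) = d%:R * eps ^+ 2 / (32 * 32).
      by rewrite /T /p2 /eta; field; rewrite !gt_eqF.
    by rewrite ler_pdivlMr //; move: d1; rewrite ler_pdivrMr //; clear; lra.
  apply: le_trans (_ : T * (1 - Ex (unif P p2) (fun G2 => (8 * dist_bp (G1 :|: G2) <= N)%N%:R)) <= _).
    by rewrite ler_wpM2l ?(le_trans ler01 T1) //; clear -cut; lra.
  rewrite -{1}(Ex_cst (unif P p2) 1) -ExB -ExZ; apply: le_Ex => // G2.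
  case: leqP => [_|lt]; first by rewrite subrr mulr0 mulr_ge0.
  rewrite subr0 mulr1; apply: le_trans NT _; rewrite -natrM ler_nat; exact: ltnW.
(* The two rounds contribute a factor 3/4 each; the final 16 comes from [9 / 128 >= 1 / 16]. *)
have : T * (9 / 16) <= 8 * mean_dist n ((1 + eps) / n%:R).
  apply: le_trans (_ : T * (3 / 4) * Ex (unif P p1) (fun G => (n%:R * eps / 16 <= Y G)%R%:R) <= _).
    by move: PY; nra.
  apply: le_trans (ler_wpM2l _ Ecouple) => //; rewrite -!ExZ.
  exact: le_Ex.
have : eps ^+ 3 * n%:R / (64 * (32 * 32) * (16 * 16)) <= T.
  rewrite /T ler_pdivlMr ?mulr_gt0 // mulrAC ler_pdivrMr ?mulr_gt0 //.
  have : d%:R * eps ^+ 2 <= (64 * (32 * 32)) by rewrite -ler_pdivlMr.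
  have : 0 <= n%:R * eps by rewrite mulr_ge0 ?ltW.
  move=> ne0 /(ler_wpM2l ne0); lra.
have -> : eps ^+ 3 * n%:R / (64 * (32 * 32) * (16 * 16) * 16) = eps ^+ 3 * n%:R / (64 * (32 * 32) * (16 * 16)) / 16 by field.
lra.
Qed.

End Lower.

(** * Transfer to G(n, p) and conclusion *)

Lemma gnp_prE (R : realType) n (p : R) (P : pred {set {set 'I_n}}) :
  gnp_pr p P = Ex (unif (pairs 'I_n) p) (fun G => (P G)%:R).
Proof.
rewrite /gnp_pr /Ex big_mkcond [in LHS](eq_bigr (fun G : {set {set 'I_n}} =>
  wt (unif (pairs 'I_n) p) G * (P G)%:R)) // => G _.
(* A family with a member that is not a pair has weight 0, so the sum may run over all families. *)
rewrite powersetE; have [GP|/subsetPn[e eG eP]] := boolP (G \subset pairs 'I_n); last first.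
  by rewrite (wt_supp eG) ?mul0r // /unif (negbTE eP).
case: (P G); rewrite ?mulr0 // mulr1 /gnp_weight /wt big_mkcond; apply: eq_bigr => e _.
rewrite /unif; case: ifP => [|eP]; first by [].
by rewrite subr0; case: ifP => // /(fintype.subsetP GP); rewrite eP.
Qed.

Lemma dist_bp_variance (R : realType) n (c : R) : 0 <= c -> c <= 2 -> (2 <= n)%N ->
  Ex (unif (pairs 'I_n) (c / n%:R)) (fun G => (dist_bp G)%:R ^+ 2) - mean_dist n (c / n%:R) ^+ 2 <=
  2 * n%:R.
Proof.
move=> c0 c2 n2; set p := unif _ _.
have pp : isprob p by apply/isprob_unif/prob_cn.
have psupp e : e \notin pairs 'I_n -> p e = 0 by move=> /negbTE eP; rewrite /p /unif eP.
apply: le_trans (efron_stein (L := 1) pp psupp _) _ => [e G _|].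
  have le1 := dist_bp_mono (subsetUr [set e] G).
  by rewrite -natrB // normr_nat lern1 leq_subLR addn1 dist_bpU1.
by rewrite expr1n mul1r sum_pairs_le.
Qed.

(** With [L = eps ^+ 3 * n], the mean lies between [c * L] and [301 * L], so a deviation below
    [c / 2 * L] stays in the window. Chebyshev's inequality bounds the failure probability by
    [2 * n / (c / 2 * L) ^+ 2], of order [1 / n]. *)
Lemma dist_bp_whp (R : realType) : exists c1 c2 : R, [/\ 0 < c1, c1 <= c2 &
  forall eps : R, 0 < eps -> eps < 1 -> exists n0 (A : R), forall n, (n0 <= n)%N -> 
   1 - A / n%:R <= gnp_pr ((1 + eps) / n%:R) (fun G : {set {set 'I_n}} =>
            c1 * eps ^+ 3 * n%:R <= (dist_bp G)%:R <= c2 * eps ^+ 3 * n%:R) <= 1].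
Proof.
(* The constant of [mean_dist_lower]. *)
pose c : R := (64 * (32 * 32) * (16 * 16) * 16)^-1.
have c0 : 0 < c by rewrite invr_gt0 !mulr_gt0.
have c1 : c <= 1 by rewrite invf_le1 ?mulr_gt0 //; lra.
exists (c / 2), 302; split; [by rewrite divr_gt0|by lra|] => eps e0 e1.
have [nu Hu] := mean_dist_upper e0 e1; have [nl Hl] := mean_dist_lower e0 e1.
exists (maxn 2 (maxn nu nl)), (2 / (c / 2 * eps ^+ 3) ^+ 2) => n.
rewrite !geq_max => /and3P[n2 nnu nnl].
have n0 : 0 < n%:R :> R by rewrite ltr0n; apply: leq_trans n2.
have p01 : 0 <= (1 + eps) / n%:R <= 1 by apply: prob_cn => //; lra.
have pp : isprob (unif (pairs 'I_n) ((1 + eps) / n%:R)) by apply: isprob_unif.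
rewrite gnp_prE; set P := (X in Ex _ X); rewrite Ex_bool_le1 // andbT.
have e30 : 0 < eps ^+ 3 by rewrite exprn_gt0.
set L := eps ^+ 3 * n%:R.
have L0 : 0 < L by rewrite mulr_gt0.
set m := mean_dist n ((1 + eps) / n%:R).
have mu : m <= 301 * L by rewrite /L mulrA; apply: Hu.
have ml : c * L <= m by rewrite mulrC; apply: Hl.
have V : Ex (unif (pairs 'I_n) ((1 + eps) / n%:R)) (fun G => (dist_bp G)%:R ^+ 2) - m ^+ 2 <= 2 * n%:R.
  by apply: dist_bp_variance => //; lra.
have t0 : 0 < c / 2 * L by rewrite mulr_gt0 // divr_gt0.
have := chebyshev pp t0 V.
have -> : 2 * n%:R / (c / 2 * L) ^+ 2 = 2 / (c / 2 * eps ^+ 3) ^+ 2 / n%:R.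
  by rewrite /L; field; rewrite !gt_eqF.
rewrite -[Ex _ (fun G => (dist_bp G)%:R)]/m => H.
suff : 1 - Ex (unif (pairs 'I_n) ((1 + eps) / n%:R))
    (fun G => (c / 2 * L <= `|(dist_bp G)%:R - m|)%R%:R) <=
    Ex (unif (pairs 'I_n) ((1 + eps) / n%:R)) P by move=> H'; apply: le_trans H'; rewrite lerD2l lerN2.
rewrite -{1}(Ex_cst (unif (pairs 'I_n) ((1 + eps) / n%:R)) 1) -ExB; apply: le_Ex => // G.
case: (leP (c / 2 * L)) => [_|]; first by rewrite subrr /P.
rewrite ltr_norml subr0 => /andP[d1 d2]; rewrite /P -!(mulrA _ (eps ^+ 3)) -/L.
rewrite (_ : _ && _ = true) //; apply/andP.
have cL : c * L <= L by rewrite ler_piMl // ltW.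
by split; lra.
Qed.

From mathcomp Require Import all_classical all_reals all_analysis.
Import numFieldNormedType.Exports.
Local Open Scope classical_set_scope.

Theorem theorem1p1 (R : realType) :
  exists c1 c2 : R, [/\ 0 < c1, c1 <= c2 &
    forall eps : R, 0 < eps -> eps < 1 ->
      (fun n : nat => gnp_pr ((1 + eps) / n%:R)
         (fun G : {set {set 'I_n}} =>
            c1 * eps ^+ 3 * n%:R <= (dist_bp G)%:R <= c2 * eps ^+ 3 * n%:R))
        @ \oo --> (1 : R)].
Proof.
have [c1 [c2 [c10 c12 H]]] := dist_bp_whp R.
exists c1, c2; split=> // eps e0 e1; have [n0 [A HA]] := H eps e0 e1.
apply/cvgrPdist_le => e egt0.
(* The successor keeps [n] positive; the sign of [A] is unknown here, hence the absolute value. *)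
exists (maxn n0.+1 (Num.bound (`|A| / e))) => // n /=; rewrite geq_max => /andP[n0n An].
have /andP[lb ub] := HA n (ltnW n0n).
have npos : 0 < n%:R :> R by rewrite ltr0n; apply: leq_trans n0n.
rewrite ger0_norm ?subr_ge0 // lerBlDr addrC -lerBlDr; apply: le_trans lb.
rewrite lerD2l lerN2 ler_pdivrMr // mulrC -ler_pdivrMr //.
apply: le_trans (_ : `|A| / e <= _); first by rewrite ler_wpM2r ?ler_norm // invr_ge0 ltW.
apply: le_trans (ltW (archi_boundP _)) _; first by rewrite divr_ge0 // ltW.
by rewrite ler_nat.
Qed.
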